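(* Assume the Continuum Hypothesis. Then there exists a maximal almost disjoint (MAD) family $\mathcal{F}_+$ of infinite subsets of $\mathbb{N}$ such that the Johnson-Lindenstrauss space $JL_2(\mathcal{F}_+)$ has Efremov's property $(\mathcal{E})$.
   Context: All Banach spaces are real; $X^*$ is the topological dual of $X$. An almost disjoint family is a family of infinite subsets of $\mathbb{N}$ any two distinct members of which have finite intersection; it is a maximal almost disjoint (MAD) family if it is maximal with respect to inclusion among almost disjoint families. For an almost disjoint family $\mathcal{F}$, the Johnson-Lindenstrauss space $JL_2(\mathcal{F})$ is the completion of $\operatorname{span}(c_0\cup\{\chi_N : N\in\mathcal{F}\})\subseteq \ell_\infty$ with respect to the norm $$\Big\|x+\sum_{r=1}^k a_r\chi_{N_r}\Big\|_{JL_2(\mathcal{F})}:=\max\Big\{\Big\|x+\sum_{r=1}^k a_r\chi_{N_r}\Big\|_\infty,\ \Big(\sum_{r=1}^k a_r^2\Big)^{1/2}\Big\},$$ where $x\in c_0$, $N_1,\dots,N_k\in\mathcal{F}$ are distinct, $a_1,\dots,a_k\in\mathbb{R}$, and $\chi_N$ is the characteristic function of $N\subseteq\mathbb{N}$. A Banach space $X$ has Efremov's property $(\mathcal{E})$ if for every convex bounded set $C\subseteq X^*$, every element of the weak$^*$-closure of $C$ is the weak$^*$-limit of a sequence in $C$. *)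

(* Defs.v *)
From HB Require Import structures.
From mathcomp Require Import all_boot all_order all_algebra.
From mathcomp Require Import all_classical all_reals all_analysis.

Set Implicit Arguments.
Unset Strict Implicit.
Unset Printing Implicit Defensive.

Import Order.TTheory GRing.Theory Num.Theory.
Import numFieldNormedType.Exports.

Local Open Scope classical_set_scope.
Local Open Scope ring_scope.

(* No cardinality lies strictly between that of nat and that of its power
   set. *)
Definition continuum_hypothesis : Prop :=
  forall A : set (set nat), countable A \/ (A #= [set: set nat])%card.

Definition almost_disjoint (F : set (set nat)) : Prop :=
  (forall A, F A -> infinite_set A) /\
  (forall A B, F A -> F B -> A <> B -> finite_set (A `&` B)).

Definition mad_family (F : set (set nat)) : Prop :=
  almost_disjoint F /\
  (forall G, almost_disjoint G -> F `<=` G -> G = F).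

Section JohnsonLindenstrauss.
Context {R : realType}.

Definition c0 : set (nat -> R^o) := [set x | x @ \oo --> (0 : R^o)].

Definition sup_norm (f : nat -> R^o) : R := sup (range (fun n => `|f n|)).

Definition jl_sum (x : nat -> R^o) (k : nat) (N : 'I_k -> set nat)
    (a : 'I_k -> R) : nat -> R^o :=
  fun n => x n + \sum_(r < k) a r * \1_(N r) n.

Definition jl_data (F : set (set nat)) (x : nat -> R^o) (k : nat)
    (N : 'I_k -> set nat) : Prop :=
  [/\ c0 x, injective N & forall r, F (N r)].

Definition jl_span (F : set (set nat)) : set (nat -> R^o) :=
  [set f | exists x k (N : 'I_k -> set nat) (a : 'I_k -> R),
     jl_data F x N /\ f = jl_sum x N a].

(* A completion of a normed space is a Banach space together with a linear
   isometry of that space onto a dense subspace; it is unique up to isometric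
   isomorphism.  The map iota is only constrained on jl_span F.  When F is
   almost disjoint, an element of jl_span F determines x and the nonzero
   coefficients a r together with the corresponding sets N r, so the right-hand
   side of the norm equation depends only on jl_sum x N a. *)
Definition is_JL2 (F : set (set nat)) (X : completeNormedModType R) : Prop :=
  exists iota : (nat -> R^o) -> X,
    [/\ forall (c : R) f g, jl_span F f -> jl_span F g ->
          iota (c *: f + g) = c *: iota f + iota g,
        forall x k (N : 'I_k -> set nat) (a : 'I_k -> R), jl_data F x N ->
          `|iota (jl_sum x N a)| =
          Num.max (sup_norm (jl_sum x N a)) (Num.sqrt (\sum_(r < k) a r ^+ 2))
      & closure (iota @` jl_span F) = [set: X]].

End JohnsonLindenstrauss.

Section Efremov.
Context {R : realType} (X : completeNormedModType R).

Definition dual : set (X -> R^o) :=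
  [set phi | linear phi /\ continuous phi].

Definition dual_norm (phi : X -> R^o) : R :=
  sup [set `|phi x| | x in [set x : X | `|x| <= 1]].

(* The weak* topology on the dual is induced by the topology of pointwise
   convergence on all functions from X to R. *)
Definition efremov : Prop :=
  forall C : set (X -> R^o), C `<=` dual ->
    @convex_set R (X -> R^o) C ->
    (exists M : R, forall phi, C phi -> dual_norm phi <= M) ->
    forall phi, dual phi -> closure (C : set {ptws X -> R^o}) phi ->
      exists u : nat -> X -> R^o,
        (forall n, C (u n)) /\ {ptws, u @ \oo --> phi}.

End Efremov.

(* Main.v *)
(* A functional on JL_2(F) is a pair in l1 + l2(F).  Let phi be in the
   weak*-closure of a bounded convex set C.  By the parallelogram law, the
   functionals in C near phi whose l2(F)-component nearly minimizes the norm
   have almost the same l2(F)-component y; only countably many A in F see the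
   difference t between the component of phi and y.  What remains is to find, in
   a sequence of subsets of the separable space l1, vectors whose averages d_n
   tend to 0 coordinatewise and satisfy d_n(A) -> t(A) for all A in F.

   Such data (rational vectors approximating the l1-components, the support of
   t and the values of t) can be coded by subsets of nat, hence under CH by
   countable ordinals.  F is built by recursion of length omega_1.  At stage b,
   for each code c <= b and each d <= b, a sequence of averages answering c on
   the countable family F_d constructed before d has been fixed; averaging
   successive vectors with almost disjoint supports makes the suprema of the
   coordinates tend to 0, and such a sequence tends to 0 on a suitable infinite
   subset of any infinite set, even simultaneously for countably many sequences.
   So the b-th infinite set, if almost disjoint from F_b, contains a new member
   of F on which all these averages tend to 0.  Maximality is automatic. *)
From HB Require Import structures.
Require Import Defs.
From mathcomp Require Import all_boot all_order all_algebra.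
From mathcomp Require Import all_classical all_reals all_analysis.
From mathcomp Require Import wochoice ring lra.

Set Implicit Arguments.
Unset Strict Implicit.
Unset Printing Implicit Defensive.

Import Order.TTheory GRing.Theory Num.Theory.
Import numFieldNormedType.Exports.

Local Open Scope classical_set_scope.
Local Open Scope ring_scope.

(** * Well-ordering the subsets of nat *)

(** Course-of-values recursion with choice: [Spec b] looks only at values below [b], so the partial
    function supplied by [Fix] can be extended by [v0] before a value is chosen. *)
Lemma wf_rec_exists (T V : Type) (W : T -> T -> Prop) (v0 : V)
    (Spec : T -> (T -> V) -> V -> Prop) :
  well_founded W ->
  (forall b f g v, (forall c, W c b -> f c = g c) ->
    Spec b f v -> Spec b g v) ->
  (forall b f, exists v, Spec b f v) ->
  exists N : T -> V, forall b, Spec b N (N b).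
Proof.
move=> wfW loc ex.
have /choice[step stepP] : forall bf : T * (T -> V), exists v, Spec bf.1 bf.2 v.
  by move=> [b f]; exact: ex.
pose ext b (prev : forall c, W c b -> V) c :=
  if pselect (W c b) is left h then prev c h else v0.
pose G b prev := step (b, @ext b prev).
pose N := Fix wfW (fun=> V) G.
exists N => b.
have -> : N b = G b (fun c _ => N c).
  apply: (Fix_eq wfW (fun=> V) G) => x f g fg.
  by congr (G x _); apply: functional_extensionality_dep => c;
    apply: functional_extensionality_dep => h; exact: fg.
apply: loc (stepP (b, _)) => c Wcb /=.
by rewrite /ext; case: pselect.
Qed.

Lemma min_well_founded (T : Type) (W : T -> T -> Prop) :
  (forall A : set T, A !=set0 -> exists2 a, A a & forall b, A b -> ~ W b a) ->
  well_founded W.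
Proof.
move=> minW a; apply: contrapT => na.
have [b nb bmin] := minW [set x | ~ Acc W x] (ex_intro _ a na).
by apply: nb; constructor => c Wcb; apply: contrapT => /bmin; apply.
Qed.

(* If every initial segment of some well-order is countable there is nothing to
   do; otherwise, by CH, the shortest uncountable one has the size of the
   continuum. *)
Lemma ch_well_order : continuum_hypothesis ->
  exists W : set nat -> set nat -> Prop,
    [/\ well_founded W,
        forall a b c, W a b -> W b c -> W a c,
        forall a b, [\/ W a b, a = b | W b a]
      & forall a, countable [set b | W b a]].
Proof.
move=> CH.
have [R0 woR] := well_ordering_principle (set nat).
pose lt a b := R0 a b /\ a <> b.
have minR (A : set (set nat)) : A !=set0 ->
    exists2 a, A a & forall b, A b -> R0 a b.
  move=> [a Aa]; have [|z [[zA zmin] _]] := woR (mem A).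
    by exists a; rewrite inE.
  exists z; first by move: zA; rewrite inE.
  by move=> b Ab; apply: zmin; rewrite inE.
(* Antisymmetry comes from uniqueness of the least element of [{a, b}]: if each is below the other,
   both are least. *)
have asym a b : R0 a b -> R0 b a -> a = b.
  have [|z [[zA zmin] zu]] := woR (mem [set a; b]).
    by exists a; rewrite inE; left.
  have refl x : R0 x x.
    by have [y -> /(_ x)] := minR [set x] (ex_intro _ x erefl); apply.
  move=> ab ba.
  have za : z = a.
    by apply: zu; split=> [|x]; rewrite inE; [left|move=> [->|->]].
  have zb : z = b.
    by apply: zu; split=> [|x]; rewrite inE; [right|move=> [->|->]].
  by rewrite -za.
have tot a b : R0 a b \/ R0 b a.
  have [c] := minR [set a; b] (ex_intro _ a (or_introl erefl)).
  by move=> [->|->] h; [left; apply: h; right|right; apply: h; left].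
have trans a b c : R0 a b -> R0 b c -> R0 a c.
  move=> ab bc.
  have [d] := minR [set a; b; c] (ex_intro _ a (or_introl (or_introl erefl))).
  move=> [[->|->]|->] h.
  - by apply: h; right.
  - have /(asym _ _ ab) -> // : R0 b a by apply: h; left; left.
  - have /(asym _ _ bc) <- // : R0 c b by apply: h; left; right.
have lttrans a b c : lt a b -> lt b c -> lt a c.
  move=> [ab nab] [bc nbc]; split; first exact: trans bc.
  by move=> ac; apply: nab; apply: asym => //; rewrite ac.
have lttri a b : [\/ lt a b, a = b | lt b a].
  have [->|nab] := pselect (a = b); first by constructor 2.
  case: (tot a b) => h; [constructor 1|constructor 3]; split => //.
  by move=> ba; apply: nab.
have wflt : well_founded lt.
  apply: min_well_founded => A /minR[a Aa amin]; exists a => // b /amin ab [ba].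
  by apply; exact: asym.
have [cnt|] := pselect (forall a, countable [set b | lt b a]).
  by exists lt; split.
move=> /existsNP[a1 na1].
have [a0 na0 a0min] := minR [set a | ~ countable [set b | lt b a]]
  (ex_intro _ a1 na1).
(* By CH there is an injection [f] of [set nat] into the segment below [a0]. The order is pulled
   back along [f]; its segments are countable by minimality of [a0]. *)
have [//|] := CH [set b | lt b a0].
rewrite card_eq_le => /andP[_ /pcard_leP/injfunPex[f fS /in2TT finj]].
have fa0 x : lt (f x) a0 by exact: fS.
exists (fun a b => lt (f a) (f b)); split.
- apply: min_well_founded => A [a Aa].
  have [_ [b Ab <-] bmin] := minR (f @` A) (ex_intro _ _ (imageP f Aa)).
  exists b => // c Ac [cb ncb]; apply: ncb; apply: asym => //.
  by apply: bmin; exists c.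
- by move=> a b c; exact: lttrans.
- move=> a b; case: (lttri (f a) (f b)) => [?|/finj ->|?].
  + by constructor 1.
  + by constructor 2.
  + by constructor 3.
- move=> a; have ca : countable [set b | lt b (f a)].
    apply: contrapT => /a0min a0f; have [fR] := fa0 a.
    by apply; exact: asym.
  apply: sub_countable ca; apply/pcard_leP/injfunPex.
  by exists f => // x y _ _ /finj.
Qed.

(** Cantor's diagonal set: the numbers coding a set to which they do not belong. *)
Lemma card_setT_uncountable : ~ countable [set: set nat].
Proof.
move=> /countable_injP[f finj].
pose A : set nat := [set n | exists B : set nat, f B = n /\ ~ B n].
have nA : ~ A (f A).
  move=> AfA; have [B [fBA nB]] := AfA.
  have BA : B = A by apply: finj => //; rewrite inE.
  by apply: nB; rewrite BA.
by apply: (nA); exists A.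
Qed.

(** * Finitely supported vectors and averages *)

Section Vectors.
Variable R : realType.
Implicit Types (A B : set nat).

(** A list of rationals stands for a finitely supported vector, read as 0 past its end. Such lists
    are countable in number, so a set of them can be coded by a subset of [nat]. *)
Definition coef (d : seq rat) (k : nat) : R := ratr d`_k.

Definition dsum (d : seq rat) A : R := \sum_(k < size d) coef d k * \1_A k.

Definition avg (T : Type) (L : seq T) (g : T -> R) : R :=
  (\sum_(d <- L) g d) / (size L)%:R.

Lemma avg_ge0 (T : Type) (L : seq T) (g : T -> R) :
  (forall d, 0 <= g d) -> 0 <= avg L g.
Proof. by move=> g0; rewrite divr_ge0 // sumr_ge0. Qed.

Lemma ler_norm_avg (T : Type) (L : seq T) (g h : T -> R) :
  (forall d, `|g d| <= h d) -> `|avg L g| <= avg L h.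
Proof.
move=> gh; rewrite normrM normfV (ger0_norm (ler0n _ _)).
rewrite ler_wpM2r ?invr_ge0 // (le_trans (ler_norm_sum _ _ _)) //.
exact: ler_sum.
Qed.

Lemma avg_near (T : eqType) (L : seq T) (g : T -> R) (a e : R) :
  (0 < size L)%N -> {in L, forall d, `|g d - a| <= e} -> `|avg L g - a| <= e.
Proof.
move=> L0 gae; have sL : 0 < (size L)%:R :> R by rewrite ltr0n.
have -> : avg L g - a = (\sum_(d <- L) (g d - a)) / (size L)%:R.
  rewrite sumrB mulrBl -/(avg L g); congr (_ - _).
  rewrite big_const_seq count_predT iter_addr_0 -[a *+ _]mulr_natr mulfK //.
  by rewrite gt_eqF.
rewrite normrM normfV (ger0_norm (ltW sL)) ler_pdivrMr //.
rewrite (le_trans (ler_norm_sum _ _ _)) // big_seq.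
rewrite (le_trans (ler_sum _ gae)) // -big_seq.
by rewrite big_const_seq count_predT iter_addr_0 mulr_natr.
Qed.

Lemma avg_sum (T : Type) (L : seq T) n (g : nat -> T -> R) :
  avg L (fun d => \sum_(k < n) g k d) = \sum_(k < n) avg L (g k).
Proof.
by rewrite /avg exchange_big mulr_suml.
Qed.

Definition to0 (u : nat -> R) :=
  forall e, 0 < e -> exists n0, forall n, (n0 <= n)%N -> `|u n| <= e.

Lemma to0_le (u v : nat -> R) :
  (forall n, `|u n| <= `|v n|) -> to0 v -> to0 u.
Proof.
move=> uv v0 e /v0[n0 h]; exists n0 => n /h; exact: le_trans.
Qed.

Lemma to0D (u v : nat -> R) : to0 u -> to0 v -> to0 (fun n => u n + v n).
Proof.
move=> u0 v0 e e0; have e2 : 0 < e / 2 by rewrite divr_gt0.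
have [n1 h1] := u0 _ e2; have [n2 h2] := v0 _ e2.
exists (maxn n1 n2) => n; rewrite geq_max => /andP[/h1 ? /h2 ?].
by rewrite (le_trans (ler_normD _ _)) // [leRHS]splitr lerD.
Qed.

Lemma to0Z (u : nat -> R) c : to0 u -> to0 (fun n => c * u n).
Proof.
move=> u0 e e0; have c0 : 0 < `|c| + 1 by rewrite ltr_wpDl.
have [n0 h] := u0 _ (divr_gt0 e0 c0); exists n0 => n /h.
rewrite ler_pdivlMr // mulrDr mulr1 normrM mulrC => hn.
by rewrite (le_trans _ hn) // lerDl.
Qed.

Lemma to0_inv : to0 (fun n => n.+1%:R^-1).
Proof.
move=> e e0; have [n0 h] : exists n0 : nat, e^-1 < n0%:R.
  by exists (Num.bound e^-1); rewrite archi_boundP // ltW // invr_gt0.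
exists n0 => n n0n; rewrite ger0_norm // invf_ple ?posrE //.
by rewrite (le_trans (ltW h)) // ler_nat ltnW.
Qed.

Lemma to0_pos_inv e : 0 < e -> exists n : nat, n.+1%:R^-1 < e :> R.
Proof.
move=> e0; have [|n0 /(_ _ (leqnn _))] := to0_inv (e := e / 2).
  by rewrite divr_gt0.
rewrite ger0_norm // => h; exists n0; rewrite (le_lt_trans h) //.
by rewrite ltr_pdivrMr // ltr_pMr // ltr1n.
Qed.

(** For nonnegative [m], the largest atom tends to 0; nothing is said about the total mass. *)
Definition flat (m : nat -> nat -> R) :=
  forall e, 0 < e -> exists n0, forall n, (n0 <= n)%N -> forall k, m n k <= e.

(** The points of [B] are chosen one by one. For the [i]-th, consider the measures [m j n] with
    [j <= i]. For large [n], flatness makes every atom at most [1/(i+1)^2], so the earlier points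
    carry at most [1/(i+1)]. The finitely many other measures have bounded support, and the new
    point is put beyond it. *)
Lemma exists_slim_subset (m : nat -> nat -> nat -> R) (s : nat -> nat -> nat)
    (A : set nat) :
  (forall j n k, 0 <= m j n k) ->
  (forall j n k, (s j n <= k)%N -> m j n k = 0) ->
  (forall j, flat (m j)) -> infinite_set A ->
  exists B : set nat, [/\ B `<=` A, infinite_set B &
    forall j e, 0 < e -> exists n0, forall n, (n0 <= n)%N ->
      forall K, \sum_(k < K) m j n k * \1_B k <= e].
Proof.
move=> m0 ms mflat Ainf.
(* Each measure m j n with j <= i that charges b i has mass at most 1/(i+1) on
   the earlier points. *)
pose Spec (i : nat) (f : nat -> nat) (v : nat) :=
  [/\ A v, forall l, (l < i)%N -> (f l < v)%N &
    forall j, (j <= i)%N -> forall n,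
      m j n v = 0 \/ \sum_(l < i) m j n (f l) <= i.+1%:R^-1].
have [||i f|b bP] :=
  @wf_rec_exists nat nat (fun a b => (a < b)%N) 0%N Spec.
- by elim/ltn_ind => i IH; constructor.
- move=> i f g v fg [Av fv mv]; split=> // [l li|j ji n].
    by rewrite -fg //; exact: fv.
  case: (mv j ji n) => [|h]; [by left|right]; rewrite (le_trans _ h) //.
  by apply: ler_sum => l _; rewrite fg.
- have e0 : 0 < (i.+1%:R * i.+1%:R)^-1 :> R by rewrite invr_gt0 mulr_gt0.
  have /choice[n0 n0P] : forall j, exists n0, forall n, (n0 <= n)%N ->
      forall k, m j n k <= (i.+1%:R * i.+1%:R)^-1.
    by move=> j; exact: mflat.
  pose n1 := \max_(j < i.+1) n0 j.
  pose b0 := (\max_(l < i) f l + \max_(j < i.+1) \max_(n < n1) s j n)%N.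
  have [v Av b0v] : exists2 v, A v & (b0 < v)%N.
    apply: contrapT => nv; apply: Ainf; apply: (sub_finite_set _ (finite_II b0.+1)).
    move=> v Av /=; rewrite ltnS leqNgt; apply/negP => b0v.
    by apply: nv; exists v.
  exists v; split=> // [l li|j ji n].
    rewrite (leq_ltn_trans _ b0v) // (leq_trans _ (leq_addr _ _)) //.
    exact: (leq_bigmax (Ordinal li)).
  have [nn1|n1n] := ltnP n n1.
    left; apply: ms; apply: ltnW; rewrite (leq_ltn_trans _ b0v) //.
    rewrite (leq_trans _ (leq_addl _ _)) //.
    rewrite -ltnS in ji.
    apply: leq_trans (leq_bigmax (Ordinal ji)).
    exact: (leq_bigmax (Ordinal nn1)).
  right; apply: (@le_trans _ _ (\sum_(l < i) (i.+1%:R * i.+1%:R)^-1)).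
    apply: ler_sum => l _; apply: n0P; apply: leq_trans n1n.
    rewrite -ltnS in ji; exact: (leq_bigmax (Ordinal ji)).
  rewrite sumr_const card_ord -[_ *+ i]mulr_natr invfM -mulrA ler_piMr //.
  by rewrite ler_pdivrMl // mulr1 ler_nat.
have bA i : A (b i) by have [] := bP i.
have bmono l i : (l < i)%N -> (b l < b i)%N by have [_ h _] := bP i; exact: h.
(* Induction on the number of points. Before [i0], flatness alone keeps the sum below [e/2]. From
   [i0] on, a measure charging [b i] has at most [e/2] on the earlier points and at most [e/2] at
   [b i]. *)
have bsum j e : 0 < e -> exists n0, forall n, (n0 <= n)%N ->
    forall i, \sum_(l < i) m j n (b l) <= e.
  move=> e0; have e2 : 0 < e / 2 by rewrite divr_gt0.
  have [i1 i1P] := to0_inv e2; pose i0 := maxn j i1.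
  have ei : 0 < e / 2 / i0.+1%:R by rewrite divr_gt0.
  have [n0 n0P] := mflat j _ ei; exists n0 => n n0n.
  have small k : m j n k <= e / 2.
    rewrite (le_trans (n0P _ n0n k)) // ler_pdivrMr // ler_peMr //.
      exact: ltW.
    by rewrite ler1n.
  elim=> [|i IH]; first by rewrite big_ord0 ltW.
  have [ii0|i0i] := ltnP i i0.
    apply: (@le_trans _ _ (\sum_(l < i.+1) (e / 2 / i0.+1%:R))).
      by apply: ler_sum => l _; exact: n0P.
    rewrite sumr_const card_ord -[_ *+ i.+1]mulr_natr -mulrA (@le_trans _ _ (e / 2)) //.
      by rewrite ler_piMr ?ltW // ltr_pdivrMl // mulr1 ltr_nat.
    by rewrite [leRHS]splitr lerDl ltW.
  rewrite big_ord_recr /=.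
  have ji : (j <= i)%N by rewrite (leq_trans (leq_maxl _ _) i0i).
  have [_ _ /(_ j ji n)[->|h]] := bP i.
  - by rewrite addr0.
  - rewrite [leRHS]splitr lerD //; rewrite (le_trans h) //.
    have := i1P i (leq_trans (leq_maxr _ _) i0i); rewrite ger0_norm //.
exists (range b); split.
- by move=> _ [i _ <-].
- apply/infiniteP/pcard_leP/injfunPex; exists b => [l _|l i _ _ bli].
    by exists l.
  by case: (ltngtP l i) => // /bmono; rewrite bli ltnn.
- move=> j e /(bsum j)[n0 n0P]; exists n0 => n /n0P h K.
  (* Reindexing along the strictly increasing [b]; [p] bounds the indices [l] with [b l < K]. *)
  suff aux p : (forall l, (b l < K)%N -> (l < p)%N) ->
      \sum_(k < K) m j n k * \1_(range b) k <= \sum_(l < p) m j n (b l).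
    apply: (le_trans (aux K _)) => // l; apply: leq_ltn_trans.
    elim: l => // l IH; exact: leq_ltn_trans IH (bmono _ _ _).
  elim: K p => [|K IH] p hp; first by rewrite big_ord0 sumr_ge0.
  rewrite big_ord_recr /= indicE; have [|] := boolP (K \in _).
    rewrite inE => -[l0 _ bl0]; have l0p : (l0 < p)%N by apply: hp; rewrite bl0.
    rewrite mulr1 -bl0; apply: (@le_trans _ _ (\sum_(l < l0.+1) m j n (b l))).
      rewrite big_ord_recr /= lerD2r bl0; apply: IH => l; rewrite -bl0.
      apply: contraTT; rewrite -!leqNgt leq_eqVlt => /orP[/eqP->//|/bmono/ltnW//].
    rewrite -!(big_mkord xpredT (fun l => m j n (b l))).
    rewrite [leRHS](big_cat_nat (leq0n _) l0p) //= lerDl sumr_ge0 //.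
  by rewrite mulr0 addr0 => _; apply: IH => l lK; apply: hp; rewrite ltnW.
Qed.
End Vectors.

(** * Codes, and sequences of averages answering them *)

Section Family.
Variable R : realType.
Implicit Types (A B : set nat) (F : set (set nat)).

Local Notation coef := (@coef R).
Local Notation dsum := (@dsum R).

Lemma coef_out d k : (size d <= k)%N -> coef d k = 0.
Proof. by move=> dk; rewrite /coef nth_default // raddf0. Qed.

Lemma coef_mkseq q K k : (k < K)%N -> coef (mkseq q K) k = ratr (q k).
Proof. by move=> kK; rewrite /coef nth_mkseq. Qed.

(** With absolute values inside the average, these are nonnegative measures dominating the averaged
    vectors; they serve as the [m j] of [exists_slim_subset]. *)
Definition absavg (L : nat -> seq (seq rat)) n k : R :=
  avg (L n) (fun d => `|coef d k|).

Lemma absavg_ge0 L n k : 0 <= absavg L n k.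
Proof. exact: avg_ge0. Qed.

Lemma absavg_out L n k : (\max_(d <- L n) size d <= k)%N -> absavg L n k = 0.
Proof.
move=> h; rewrite /absavg /avg big_seq big1 ?mul0r // => d dL.
rewrite coef_out ?normr0 // (leq_trans _ h) //.
by rewrite (big_rem d) //= leq_maxl.
Qed.

Lemma flat_nil : flat (absavg (fun=> [::])).
Proof.
by move=> e e0; exists 0%N => n _ k; rewrite /absavg /avg big_nil mul0r ltW.
Qed.

Lemma dsumE d A K : (size d <= K)%N ->
  dsum d A = \sum_(k < K) coef d k * \1_A k.
Proof.
move=> dK; rewrite /dsum -!(big_mkord xpredT (fun k => coef d k * \1_A k)).
rewrite [RHS](big_cat_nat (leq0n _) dK) /=.
rewrite [X in _ + X]big_nat [X in _ + X]big1 ?addr0 // => k /andP[dk _].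
by rewrite coef_out ?mul0r.
Qed.

Lemma avg_dsum_le L n A K : (\max_(d <- L n) size d <= K)%N ->
  `|avg (L n) (dsum^~ A)| <= \sum_(k < K) absavg L n k * \1_A k.
Proof.
move=> LK; have -> : \sum_(k < K) absavg L n k * \1_A k =
    avg (L n) (fun d => \sum_(k < K) `|coef d k| * \1_A k).
  rewrite (avg_sum _ _ (fun k d => `|coef d k| * \1_A k)).
  apply: eq_bigr => k _; rewrite /absavg /avg mulrAC.
  by rewrite mulr_suml.
rewrite /avg normrM normfV (ger0_norm (ler0n _ _)).
rewrite ler_wpM2r ?invr_ge0 // (le_trans (ler_norm_sum _ _ _)) //.
rewrite big_seq [leRHS]big_seq; apply: ler_sum => d dL.
rewrite (@dsumE _ _ K); last first.
  by rewrite (leq_trans _ LK) // (big_rem d) //= leq_maxl.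
rewrite (le_trans (ler_norm_sum _ _ _)) //; apply: ler_sum => k _.
by rewrite normrM (@ger0_norm _ (\1_A k)) ?indicE ?ler0n.
Qed.

(** What clustering at [phi] becomes for rational vectors: on finite subfamilies the values come
    within the fixed error [r] of [t], while any initial block of coordinates can be made
    arbitrarily small. *)
Definition approx (D : set (seq rat)) (t : set nat -> R) (r : R) F :=
  forall (G : seq (set nat)) K e, (forall N, N \in G -> F N) -> 0 < e ->
    exists d, [/\ D d, forall k, (k < K)%N -> `|coef d k| <= e &
      forall N, N \in G -> `|dsum d N - t N| <= r].

(** Each new vector is at most [1/(n+1)] on the supports of the previous ones. At a coordinate
    inside those supports it adds at most that; outside, it is the only contribution and is at most
    [M]. The total over [n+1] vectors is at most [M + 1]. *)
Lemma approx_run (D : set (seq rat)) t r F (M : R) (G : seq (set nat)) n :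
  (forall N, N \in G -> F N) ->
  approx D t r F -> (forall d, D d -> forall k, `|coef d k| <= M) ->
  exists L : seq (seq rat), [/\ size L = n.+1, {in L, forall d, D d},
    {in L, forall d N, N \in G -> `|dsum d N - t N| <= r} &
    forall k, \sum_(d <- L) `|coef d k| <= M + 1].
Proof.
move=> GF ap DM; have e0 : 0 < n.+1%:R^-1 :> R by rewrite invr_gt0.
have M0 : 0 <= M.
  have [//|d [Dd _ _]] := ap [::] 0%N 1 _ ltr01.
  by rewrite (le_trans _ (DM d Dd 0%N)).
suff run p : exists L : seq (seq rat), [/\ size L = p, {in L, forall d, D d},
    {in L, forall d N, N \in G -> `|dsum d N - t N| <= r} &
    forall k, \sum_(d <- L) `|coef d k| <= M + p%:R * n.+1%:R^-1].
  have [L [sL LD LG Ls]] := run n.+1.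
  by exists L; split=> // k; have := Ls k; rewrite mulfV.
elim: p => [|p [L [sL LD LG Ls]]].
  by exists [::]; split=> // k; rewrite big_nil mul0r addr0.
have [d [Dd dK dG]] := ap G (\max_(d <- L) size d) _ GF e0.
exists (d :: L); split=> /=; first by rewrite sL.
- by move=> x; rewrite inE => /orP[/eqP->|/LD].
- by move=> x; rewrite inE => /orP[/eqP->|/LG].
- move=> k; rewrite big_cons; have [kK|kK] := ltnP k (\max_(d <- L) size d).
    rewrite -natr1 mulrDl mul1r addrA addrC lerD //; exact: dK.
  rewrite big_seq big1 ?addr0.
    by rewrite (le_trans (DM _ Dd k)) // lerDl mulr_ge0 // ltW.
  move=> x xL; rewrite coef_out ?normr0 // (leq_trans _ kK) //.
  by rewrite (big_rem x) //= leq_maxl.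
Qed.

(* (D, S, t): sets D n of rational vectors, and the function on sets with value
   t j at S j and 0 elsewhere. *)
Definition code : Type :=
  ((nat -> set (seq rat)) * (nat -> set nat) * (nat -> R))%type.

Definition target (c : code) (A : set nat) : R :=
  if pselect (exists j, c.1.2 j = A) is left h then c.2 (projT1 (cid h)) else 0.

(** A code is determined by countably many yes-no questions: membership in the [D j] and [S j], and
    which rationals lie below [t j]. So codes inject into [set nat], and [dec] is a left inverse. *)
Lemma exists_decoding : exists dec : set nat -> code,
  forall c, exists a, dec a = c.
Proof.
pose K : Type := (nat * seq rat + nat * nat + nat * rat)%type.
pose enc (c : code) : set nat := [set n | exists k : K, pickle k = n /\
  match k with
  | inl (inl p) => c.1.1 p.1 p.2
  | inl (inr p) => c.1.2 p.1 p.2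
  | inr p => ratr p.2 < c.2 p.1
  end].
have encinj : injective enc.
  move=> [[D S] t] [[D' S'] t'] e.
  have eK (k : K) : match k with
      | inl (inl p) => D p.1 p.2 | inl (inr p) => S p.1 p.2
      | inr p => (ratr p.2 < t p.1 : Prop) end =
    match k with
      | inl (inl p) => D' p.1 p.2 | inl (inr p) => S' p.1 p.2
      | inr p => (ratr p.2 < t' p.1 : Prop) end.
    have /seteqP[h1 h2] := e.
    apply/propext; split=> h.
      have [|k' [/(pcan_inj (@pickleK K)) ->]//] := h1 (pickle k).
      by exists k.
    have [|k' [/(pcan_inj (@pickleK K)) ->]//] := h2 (pickle k).
    by exists k.
  congr (_, _, _); apply/funext => j; [apply/funext => d|apply/funext => d|].
  - exact: (eK (inl (inl (j, d)))).
  - exact: (eK (inl (inr (j, d)))).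
  - have tq q : (ratr q < t j) = (ratr q < t' j).
      by have := eK (inr (j, q)) => /= hq; apply/idP/idP; rewrite hq.
    apply/eqP; case: ltgtP => // /rat_in_itvoo[q]; rewrite in_itv /= => /andP[h].
      by rewrite -tq => /(lt_trans h); rewrite ltxx.
    by rewrite tq => /(lt_trans h); rewrite ltxx.
pose c0 : code := (fun=> set0, fun=> set0, fun=> 0).
exists (fun a => if pselect (exists c, enc c = a) is left h then projT1 (cid h)
  else c0) => c; exists (enc c); case: pselect => [h|]; last by case; exists c.
by case: (cid h) => c' /= /encinj.
Qed.

(** Flatness is stronger than coordinatewise convergence to 0; it is what allows later members of
    the family to be chosen slim. *)
Definition answers F (c : code) (L : nat -> seq (seq rat)) :=
  [/\ forall n, (0 < size (L n))%N /\ {in L n, forall d, c.1.1 n d},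
      forall N, F N -> to0 (fun n => avg (L n) (dsum^~ N) - target c N) &
      flat (absavg L)].

(** Exhaust the countable [F] by finite subfamilies [e n] and average the [n+1] vectors that
    [approx_run] gives for [e n]: the error on [e n] is at most [r n], and every averaged coordinate
    is at most [(M+1)/(n+1)]. *)
Lemma exists_answers F (c : code) (r : nat -> R) (M : R) :
  countable F -> to0 r ->
  (forall n, approx (c.1.1 n) (target c) (r n) F) ->
  (forall n d, c.1.1 n d -> forall k, `|coef d k| <= M) ->
  exists L, answers F c L.
Proof.
move=> Fc r0 ap DM.
have [e eP] : exists e : nat -> seq (set nat),
    (forall n N, N \in e n -> F N) /\
    (forall N, F N -> exists n0, forall n, (n0 <= n)%N -> N \in e n).
  have [f finj] := countable_injP _ Fc.
  have gP n : exists s : seq (set nat), forall N, N \in s <-> F N /\ (f N < n)%N.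
    have : finite_set [set N | F N /\ (f N < n)%N].
      apply: (card_le_finite _ (finite_II n)); apply/pcard_leP/injfunPex.
      exists f => [N [_]//|N N'].
      by rewrite !inE => -[FN _] [FN' _]; apply: finj; rewrite inE.
    move=> /finite_seqP[s sE]; exists s => N.
    by rewrite (_ : N \in s <-> [set` s] N) // -sE.
  have [g gP'] := choice gP; exists g; split=> [n N /gP'[]//|N FN].
  by exists (f N).+1 => n fn; apply/gP'.
have [eF eE] := eP.
have /choice[L LP] n := approx_run n (eF n) (ap n) (DM n).
exists L; split.
- by move=> n; have [-> ? _ _] := LP n.
- move=> N FN e1 e10; have [n1 h1] := eE N FN; have [n2 h2] := r0 _ e10.
  exists (maxn n1 n2) => n; rewrite geq_max => /andP[/h1 Nn /h2 rn].
  apply: (@le_trans _ _ (r n)); last by rewrite (le_trans _ rn) // ler_norm.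
  have [sL _ Lr _] := LP n.
  by apply: avg_near => [|d dL]; [rewrite sL|exact: Lr].
- move=> e1 e10; have [n0 h0] := to0Z (M + 1) (@to0_inv R) e10.
  exists n0 => n /h0 hn k; apply: le_trans hn; apply: le_trans (ler_norm _).
  have [sL _ _ Ls] := LP n; rewrite /absavg /avg sL ler_wpM2r //.
Qed.
End Family.

(** * The almost disjoint family *)

Lemma countable_setU (T : Type) (A B : set T) :
  countable A -> countable B -> countable (A `|` B).
Proof.
move=> cA cB; rewrite -bigcup2E; apply: bigcup_countable => // -[|[|n]] _ //=.
Qed.

Lemma countable_enum (T : Type) (A : set T) : countable A -> A !=set0 ->
  exists h : nat -> T, A = range h.
Proof.
move=> /countable_injP[f finj] [a Aa].
exists (fun n => if pselect (exists2 x, A x & f x = n) is left e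
  then projT1 (cid2 e) else a).
apply/seteqP; split=> [x Ax|_ [n _ <-]]; last first.
  by case: pselect => // e; case: cid2.
exists (f x) => //; case: pselect => [e|]; last by case; exists x.
by case: cid2 => y Ay /= /finj; apply; rewrite inE.
Qed.

Section Construction.
Variable R : realType.

Local Notation coef := (@coef R).
Local Notation dsum := (@dsum R).
Local Notation absavg := (@absavg R).

Definition slim (L : nat -> seq (seq rat)) (v : set nat) :=
  forall e, 0 < e -> exists n0, forall n, (n0 <= n)%N ->
    forall K, \sum_(k < K) absavg L n k * \1_v k <= e.

Lemma slim_dsum L v : slim L v -> to0 (fun n => avg (L n) (dsum^~ v)).
Proof.
move=> sL e /sL[n0 h]; exists n0 => n /h hn.
apply: (le_trans (@avg_dsum_le R L n v _ (leqnn _))); exact: hn.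
Qed.

Lemma exists_slim (Ls : nat -> nat -> seq (seq rat)) (A : set nat) :
  (forall j, flat (absavg (Ls j))) -> infinite_set A ->
  exists v, [/\ v `<=` A, infinite_set v & forall j, slim (Ls j) v].
Proof.
move=> fL Ainf.
have [||||v [vA vinf h]] := @exists_slim_subset R (fun j => absavg (Ls j))
  (fun j n => \max_(d <- Ls j n) size d) A.
- by move=> j n k; exact: absavg_ge0.
- by move=> j n k; exact: absavg_out.
- exact: fL.
- exact: Ainf.
- by exists v.
Qed.

(** Infinitely many disjoint infinite sets, put into the family from the start so that it is
    infinite. *)
Definition seed (i : nat) : set nat := [set k | exists n : nat, k = pickle (i, n)].

Lemma seed_infinite i : infinite_set (seed i).
Proof.
apply/infiniteP/pcard_leP/injfunPex; exists (fun n => pickle (i, n)) => [n _|n m _ _].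
  by exists n.
by move=> /(pcan_inj (@pickleK _)) [].
Qed.

Lemma seed_disjoint i j : i <> j -> seed i `&` seed j = set0.
Proof.
move=> ij; apply/seteqP; split=> // k [[n ->] [m]].
by move=> /(pcan_inj (@pickleK _)) [].
Qed.

(** The combinatorial property from which (E) is derived. Countable support of [t] on [F] is what
    lets it be recorded in a code. *)
Definition answering (F : set (set nat)) :=
  forall (D : nat -> set (seq rat)) (t : set nat -> R) (r : nat -> R) (M : R),
    to0 r -> countable [set N | F N /\ t N <> 0] ->
    (forall n, approx (D n) t (r n) F) ->
    (forall n d, D n d -> forall k, `|coef d k| <= M) ->
    exists L : nat -> seq (seq rat), [/\
      forall n, (0 < size (L n))%N /\ {in L n, forall d, D n d},
      forall N, F N -> to0 (fun n => avg (L n) (dsum^~ N) - t N) &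
      forall k, to0 (fun n => avg (L n) (coef^~ k))].

Lemma ch_answering_mad : continuum_hypothesis ->
  exists F : set (set nat), [/\ mad_family F, infinite_set F & answering F].
Proof.
move=> /ch_well_order[W [wfW Wtr Wtri Wc]].
have Wirr b : ~ W b b by elim: (wfW b) => x _ IH xx; exact: (IH x xx xx).
pose Wle a b := a = b \/ W a b.
have Wlec b : countable [set a | Wle a b].
  have -> : [set a | Wle a b] = b |` [set a | W a b] by [].
  by apply: countable_setU => //; exact: countable1.
have [dec decP] := exists_decoding R.
(* One answer is fixed for each code and family. Where none exists, empty lists are used: they are
   flat too, so slim sets can be chosen for all pairs alike. *)
have /choice[L LP] : forall cF : code R * set (set nat),
    exists L, flat (absavg L) /\
      ((exists L', answers cF.2 cF.1 L') -> answers cF.2 cF.1 L).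
  move=> [c F]; have [[L' hL']|nL] := pselect (exists L', answers F c L').
    by exists L'; split=> //; case: hL'.
  by exists (fun=> [::]); split=> //; exact: flat_nil.
(* [Fam d f] is what has been built before stage [d]; the value [set0] means that a stage adds
   nothing. *)
pose Fam (d : set nat) (f : set nat -> set nat) : set (set nat) :=
  range seed `|` [set N | exists b, [/\ W b d, f b <> set0 & N = f b]].
pose good (b : set nat) (F : set (set nat)) :=
  infinite_set b /\ forall A, F A -> finite_set (A `&` b).
(* The candidate at stage [b] is the set [b] itself, so every subset of [nat] gets its turn. *)
pose Spec b f v :=
  (good b (Fam b f) -> [/\ v `<=` b, infinite_set v &
    forall c d, Wle c b -> Wle d b -> slim (L (dec c, Fam d f)) v]) /\
  (~ good b (Fam b f) -> v = set0).
have Famloc b f g d : (forall c, W c b -> f c = g c) -> Wle d b ->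
    Fam d f = Fam d g.
  move=> fg db; have fg' c : W c d -> f c = g c.
    by move=> cd; apply: fg; case: db => [<-//|]; exact: Wtr.
  congr (_ `|` _); apply/seteqP.
  by split=> N [c [cd c0 ->]]; exists c; rewrite ?fg' // -fg'.
have [b f g v fg [h1 h2]|b f|N NP] :=
  @wf_rec_exists _ _ W (set0 : set nat) Spec wfW.
- have E d : Wle d b -> Fam d g = Fam d f.
    by move=> db; apply: Famloc db => c cb; rewrite fg.
  rewrite /Spec E; last by left.
  split=> // /h1[vb vinf hv]; split=> // c d cb db.
  by rewrite E //; exact: hv.
- have [gb|ngb] := pselect (good b (Fam b f)); last by exists set0.
  (* The pairs of indices up to [b] are listed through [h] and [unpickle]; numbers coding no pair
     get empty lists. *)
  have [h hE] := countable_enum (Wlec b) (ex_intro _ b (or_introl erefl)).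
  pose Ls j := if unpickle j is Some (c, d) then L (dec (h c), Fam (h d) f)
    else fun=> [::].
  have [||v [vb vinf vs]] := @exists_slim Ls b.
  + move=> j; rewrite /Ls; case: (unpickle j) => [[c d]|].
      by case: (LP (dec (h c), Fam (h d) f)).
    exact: flat_nil.
  + by case: gb.
  + exists v; split=> // _; split=> // c d.
    have hs x : Wle x b -> exists j, h j = x.
      by move=> xb; have : [set a | Wle a b] x by []; rewrite hE => -[j _]; exists j.
    move=> /hs[i <-] /hs[j <-]; have := vs (pickle (i, j)).
    by rewrite /Ls pickleK.
pose F : set (set nat) :=
  range seed `|` [set A | exists b, N b <> set0 /\ A = N b].
have FamF d : Fam d N `<=` F.
  by move=> A [|[b [_ b0 ->]]]; [left|right; exists b].
have NS b : N b <> set0 -> good b (Fam b N) /\ [/\ N b `<=` b, infinite_set (N b) &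
    forall c d, Wle c b -> Wle d b -> slim (L (dec c, Fam d N)) (N b)].
  have [h1 h2] := NP b; move=> b0.
  have gb : good b (Fam b N) by apply: contrapT => /h2.
  by split=> //; exact: h1.
have NFam b : N b <> set0 -> forall A, Fam b N A -> finite_set (A `&` N b).
  move=> /NS[[_ g] [Nb _ _]] A /g; apply: sub_finite_set.
  by move=> x [? /Nb].
have adF : almost_disjoint F.
  split=> [A [[i _ <-]|[b [b0 ->]]]|A B FA FB AB].
  - exact: seed_infinite.
  - by have [_ []] := NS _ b0.
  - case: FA FB AB => [[i _ <-]|[b [b0 ->]]] [[j _ <-]|[c [c0 ->]]] AB.
    + have ij : i <> j by move=> ij; apply: AB; rewrite ij.
      by rewrite seed_disjoint.
    + by apply: NFam => //; left.
    + by rewrite setIC; apply: NFam => //; left.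
    + have [bc|bc|cb] := Wtri b c.
      * by apply: NFam => //; right; exists b.
      * by case: AB; rewrite bc.
      * by rewrite setIC; apply: NFam => //; right; exists c.
exists F; split.
- split=> // G [Ginf Gad] FG; apply/seteqP; split=> // A GA.
  apply: contrapT => nFA.
  (* A set [A] missing from [F] and almost disjoint from its members is accepted at its own stage,
     which puts an infinite subset [N A] of [A] into [F]: a contradiction. *)
  have gA : good A (Fam A N).
    split; first exact: Ginf.
    move=> B /FamF FB; apply: Gad => //; first exact: FG.
    by move=> BA; apply: nFA; rewrite -BA.
  have [/(_ gA)[NA Ninf _] _] := NP A.
  have FN : F (N A).
    right; exists A; split=> // N0; apply: Ninf; rewrite N0 //.
  have NAA : N A <> A by move=> e; apply: nFA; rewrite -e.
  have := Gad _ _ (FG _ FN) GA NAA.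
  by rewrite setIidl.
- apply: (@sub_infinite_set _ (range seed)); first by move=> A; left.
  apply/infiniteP/pcard_leP/injfunPex; exists seed => [i _|i j _ _ ij].
    by exists i.
  apply: contrapT => /seed_disjoint; rewrite ij setIid => j0.
  by have := @seed_infinite j; rewrite j0; apply.
- move=> D t r M r0 tc ap DM.
  (* [seed 0] makes the set nonempty, so that it can be enumerated by a sequence. *)
  pose T := seed 0%N |` [set A | F A /\ t A <> 0].
  have [S SE] : exists S : nat -> set nat, T = range S.
    apply: countable_enum; last by exists (seed 0%N); left.
    by apply: countable_setU => //; exact: countable1.
  pose c : code R := (D, S, t \o S).
  have ct A : F A -> target c A = t A.
    move=> FA; rewrite /target; case: pselect => [h|nh].
      by case: cid => j /= ->.
    apply/esym; apply: contrapT => tA; apply: nh.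
    have : T A by right.
    by rewrite SE => -[j _ <-]; exists j.
  have [g gc] := decP c.
  have /choice[bet betP] A : exists b, F A -> range seed A \/ (N b <> set0 /\ A = N b).
    have [[?|[b hb]]|?] := pselect (F A); last by exists set0.
      by exists set0; left.
    by exists b; right.
  (* Countably many countable segments do not exhaust [set nat], so some stage [d] comes after the
     code [g] and after the entry of every set in the support of [t]. *)
  have [d dP] : exists d, W g d /\ forall j, W (bet (S j)) d.
    pose U := [set a | Wle a g] `|` \bigcup_j [set a | Wle a (bet (S j))].
    have Uc : countable U.
      by apply: countable_setU => //; apply: bigcup_countable => // j _.
    have [d nU] : exists d, ~ U d.
      apply: contrapT => nd; apply: card_setT_uncountable.
      apply: (sub_countable _ Uc); apply: subset_card_le => a _.
      by apply: contrapT => na; apply: nd; exists a.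
    have Wn x : ~ Wle d x -> W x d.
      by move=> dx; case: (Wtri x d) => // [xd|dx']; case: dx; [left|right].
    exists d; split; first by apply: Wn => h; apply: nU; left.
    by move=> j; apply: Wn => h; apply: nU; right; exists j.
  have tFam A : F A -> ~ Fam d N A -> t A = 0.
    move=> FA nA; apply: contrapT => tA; have : T A by right.
    rewrite SE => -[j _ SA]; apply: nA.
    have [|[b0 Ab]] := betP A FA; first by left.
    by right; exists (bet A); split=> //; rewrite -SA; apply: dP.2.
  have Fdc : countable (Fam d N).
    apply: countable_setU; first exact: sub_countable (card_image_le _ _) _.
    apply: (@sub_countable _ _ _ (N @` [set b | W b d])).
      by apply: subset_card_le => A [b [bd _ ->]]; exists b.
    exact: sub_countable (card_image_le _ _) (Wc d).
  have : answers (Fam d N) (dec g) (L (dec g, Fam d N)).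
    have [_] := LP (dec g, Fam d N); apply; rewrite gc /=.
    apply: (@exists_answers R (Fam d N) c r M) => //= n G K e GF e0.
    have [x [Dx xK xG]] := ap n G K e (fun A h => FamF _ _ (GF A h)) e0.
    exists x; split=> // A AG; rewrite ct; first exact: xG.
    exact/FamF/GF.
  rewrite gc => -[LD Lt Lf]; set L0 := L _ in LD Lt Lf.
  exists L0; split=> //.
  (* Members present before [d] are handled by the answer itself. A later member was chosen slim for
     this very sequence, and [t] vanishes on it. *)
  + move=> A FA; have [FdA|nFdA] := pselect (Fam d N A).
      by rewrite -ct //; exact: Lt.
    rewrite tFam //; have [|[b0 Ab]] := betP A FA.
      by move=> sA; case: nFdA; left.
    have := slim_dsum _; rewrite {1}Ab.
    have [_ [_ _ hs]] := NS _ b0.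
    have db : Wle d (bet A).
      have [h|->|] := Wtri d (bet A); [by right|by left|move=> h].
      by case: nFdA; right; exists (bet A).
    have gb : Wle g (bet A).
      by right; case: db => [<-|]; [|apply: Wtr]; exact: dP.1.
    have := slim_dsum (hs _ _ gb db); rewrite -Ab gc -/L0.
    move=> h0 _ e /h0[n0 hn]; exists n0 => n /hn; by rewrite subr0.
  + move=> k e /Lf[n0 h]; exists n0 => n /h hn.
    apply: le_trans (hn k); exact: ler_norm_avg.
Qed.
End Construction.

(** * Absolutely summable sequences *)

Section AbsolutelySummable.
Variable R : realType.
Implicit Types (x z : nat -> R) (A : set nat).

Local Notation coef := (@coef R).
Local Notation dsum := (@dsum R).

Lemma to0_eq0 (a : R) : to0 (fun=> a) -> a = 0.
Proof.
move=> a0; apply/eqP/negPn/negP => an0.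
have [|n /(_ _ (leqnn n))] := a0 (`|a| / 2).
  by rewrite divr_gt0 // normr_gt0.
by rewrite leNgt ltr_pdivrMr // ltr_pMr ?normr_gt0 // ltr1n.
Qed.

Lemma to0_le_of (u : nat -> R) (a b : R) :
  to0 u -> (exists n0, forall n, (n0 <= n)%N -> a <= b + u n) -> a <= b.
Proof.
move=> u0 [n0 h]; apply/ler_addgt0Pr => e /u0[n1 hn].
have := h _ (leq_maxl n0 n1); have := hn _ (leq_maxr n0 n1).
by rewrite ler_norml => /andP[_ ?] /le_trans; apply; rewrite lerD2l.
Qed.

Definition psum x A K : R := \sum_(k < K) x k * \1_A k.

Definition l1 M x := forall K, \sum_(k < K) `|x k| <= M.

Lemma l1_le M x k : l1 M x -> `|x k| <= M.
Proof.
move=> /(_ k.+1); apply: le_trans; rewrite big_ord_recr /= lerDr.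
exact: sumr_ge0.
Qed.

Lemma psum_le M x A K : l1 M x -> `|psum x A K| <= M.
Proof.
move=> /(_ K); apply: le_trans; rewrite (le_trans (ler_norm_sum _ _ _)) //.
apply: ler_sum => k _; rewrite normrM ler_piMr // indicE normr_nat.
by case: (_ \in _).
Qed.

Lemma l1D M N x z : l1 M x -> l1 N z -> l1 (M + N) (fun k => x k + z k).
Proof.
move=> hx hz K; apply: le_trans (lerD (hx K) (hz K)); rewrite -big_split /=.
by apply: ler_sum => k _; exact: ler_normD.
Qed.

Lemma l1B M N x z : l1 M x -> l1 N z -> l1 (M + N) (fun k => x k - z k).
Proof.
move=> hx hz; apply: l1D => // K.
by under eq_bigr do rewrite normrN; exact: hz.
Qed.

Lemma l1_tail M x e : l1 M x -> 0 < e -> exists K0, forall K,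
  (K0 <= K)%N -> \sum_(K0 <= k < K) `|x k| <= e.
Proof.
move=> hx e0; pose E := [set \sum_(k < K) `|x k| | K in [set: nat]].
have supE : has_sup E.
  by split; [exists (\sum_(k < 0) `|x k|); exists 0%N|exists M => _ [K _ <-]].
have [_ [K0 _ <-] h] := sup_adherent e0 supE; exists K0 => K K0K.
have : \sum_(k < K) `|x k| <= sup E.
  by apply: sup_upper_bound => //; exists K.
move: h; rewrite -!(big_mkord xpredT (fun k => `|x k|)) => h.
rewrite (big_cat_nat (leq0n _) K0K) /=; lra.
Qed.

Definition ssum x A : R := limn (psum x A).

Lemma ssumP M x A : l1 M x -> to0 (fun K => ssum x A - psum x A K).
Proof.
move=> hx; have cv : cvgn (psum x A).
  have -> : psum x A = series (fun k => x k * \1_A k).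
    by rewrite seriesEord.
  apply: normed_cvg; apply: nondecreasing_is_cvgn.
    by apply: nondecreasing_series => n _ _; exact: normr_ge0.
  exists M => _ [K _ <-]; apply: le_trans (hx K).
  rewrite -(big_mkord xpredT (fun k => `|x k|)) /=.
  apply: ler_sum => k _; rewrite normrM ler_piMr // indicE normr_nat.
  by case: (_ \in _).
move=> e e0; have /cvgrPdist_le/(_ e e0)[n0 _ h] := cv.
by exists n0 => n; exact: h.
Qed.

Lemma ssum_unique M x A s : l1 M x -> to0 (fun K => s - psum x A K) ->
  ssum x A = s.
Proof.
move=> /(@ssumP _ _ A) h1 h2; apply/eqP; rewrite -subr_eq0; apply/eqP.
apply: to0_eq0; have := to0D h1 (to0Z (-1) h2).
apply: to0_le => n /=; rewrite le_eqVlt; apply/orP; left; apply/eqP; congr `|_|; ring.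
Qed.

Lemma ssum_le M x A : l1 M x -> `|ssum x A| <= M.
Proof.
move=> hx; apply: (@to0_le_of (fun K => `|ssum x A - psum x A K|)).
  by apply: to0_le (ssumP A hx) => n; rewrite normr_id.
exists 0%N => n _; rewrite -[X in `|X|](subrK (psum x A n)) addrC.
rewrite (le_trans (ler_normD _ _)) // lerD2r //; exact: psum_le.
Qed.

Lemma ssum_lin M N x z a A : l1 M x -> l1 N z ->
  ssum (fun k => a * x k + z k) A = a * ssum x A + ssum z A.
Proof.
move=> hx hz; apply: (@ssum_unique (`|a| * M + N)).
  apply: l1D => // K; under eq_bigr do rewrite normrM.
  by rewrite -mulr_sumr ler_wpM2l.
have := to0D (to0Z a (ssumP A hx)) (ssumP A hz); apply: to0_le => K.
rewrite le_eqVlt; apply/orP; left; apply/eqP; congr `|_|; rewrite /psum.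
under [in LHS]eq_bigr do rewrite mulrDl -mulrA.
rewrite big_split /= -mulr_sumr; ring.
Qed.

Lemma l1_coef d : l1 (\sum_(k < size d) `|coef d k|) (coef d).
Proof.
move=> K; rewrite -!(big_mkord xpredT (fun k => `|coef d k|)).
have [dK|/ltnW Kd] := leqP (size d) K.
  rewrite (big_cat_nat (leq0n _) dK) /= [X in _ + X]big_nat.
  rewrite [X in _ + X]big1 ?addr0 // => k /andP[dk _].
  by rewrite coef_out ?normr0.
rewrite [leRHS](big_cat_nat (leq0n _) Kd) /= lerDl.
exact: sumr_ge0.
Qed.

Lemma ssum_coef d A : ssum (coef d) A = dsum d A.
Proof.
apply: (@ssum_unique (\sum_(k < size d) `|coef d k|)).
  exact: l1_coef.
move=> e e0; exists (size d) => K dK.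
by rewrite (dsumE _ _ dK) subrr normr0 ltW.
Qed.

(** Coordinates before [K0] are rounded to rationals with total error at most [e/2]; the tail
    carries at most [e/2]. *)
Lemma l1_rat_dense M x e : l1 M x -> 0 < e ->
  exists d, l1 e (fun k => x k - coef d k).
Proof.
move=> hx e0; have e2 : 0 < e / 2 by rewrite divr_gt0.
have [K0 hK0] := l1_tail hx e2.
have e3 : 0 < e / 2 / K0.+1%:R by rewrite divr_gt0.
have /choice[q qP] k : exists q : rat, `|x k - ratr q| <= e / 2 / K0.+1%:R.
  have [|q] := @rat_in_itvoo R (x k) (x k + e / 2 / K0.+1%:R).
    by rewrite ltrDl.
  rewrite in_itv /= => /andP[h1 h2]; exists q.
  by rewrite distrC ger0_norm ?subr_ge0 ?(ltW h1) // lerBlDl ltW.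
exists (mkseq q K0) => K.
have lt0 k : (k < K0)%N -> `|x k - coef (mkseq q K0) k| <= e / 2 / K0.+1%:R.
  by move=> kK; rewrite coef_mkseq.
have le K' : (K' <= K0)%N -> \sum_(k < K') `|x k - coef (mkseq q K0) k| <= e / 2.
  move=> K'0; apply: (@le_trans _ _ (\sum_(k < K') (e / 2 / K0.+1%:R))).
    by apply: ler_sum => k _; apply: lt0; rewrite (leq_trans _ K'0).
  rewrite sumr_const card_ord -[_ *+ _]mulr_natr -mulrA ler_piMr ?ltW //.
  by rewrite ltr_pdivrMl // mulr1 ltr_nat ltnS.
have [KK|/ltnW KK] := leqP K K0.
  by rewrite (le_trans (le _ KK)) // [leRHS]splitr lerDl ltW.
rewrite -(big_mkord xpredT (fun k => `|x k - coef (mkseq q K0) k|)).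
rewrite (big_cat_nat (leq0n _) KK) /= [leRHS]splitr lerD //.
  by rewrite big_mkord; exact: le.
apply: le_trans (hK0 _ KK); rewrite big_nat [leRHS]big_nat ler_sum // => k.
by move=> /andP[kK _]; rewrite coef_out ?subr0 // size_mkseq.
Qed.

End AbsolutelySummable.

(** * Functionals on Johnson-Lindenstrauss spaces *)

Lemma to0_sum (R : realType) (I : Type) (s : seq I) (w : I -> nat -> R) :
  (forall i, to0 (w i)) -> to0 (fun n => \sum_(i <- s) w i n).
Proof.
move=> w0; elim: s => [|i s IH].
  by move=> e e0; exists 0%N => n _; rewrite big_nil normr0 ltW.
have := to0D (w0 i) IH; apply: to0_le => n.
by rewrite big_cons.
Qed.

Lemma finite_set_nat_ub (A : set nat) : finite_set A ->
  exists m, forall n, A n -> (n < m)%N.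
Proof.
move=> /finite_seqP[s ->]; exists (\max_(i <- s) i).+1 => n /= ns.
by rewrite ltnS (big_rem n) //= leq_maxl.
Qed.

Section JL.
Variable R : realType.
Variables (F : set (set nat)) (X : completeNormedModType R).
Variable iota : (nat -> R^o) -> X.
Hypothesis iota_lin : forall (c : R) f g, jl_span F f -> jl_span F g ->
  iota (c *: f + g) = c *: iota f + iota g.
Hypothesis iota_norm : forall x k (N : 'I_k -> set nat) (a : 'I_k -> R),
  jl_data F x N -> `|iota (jl_sum x N a)| =
    Num.max (sup_norm (jl_sum x N a)) (Num.sqrt (\sum_(r < k) a r ^+ 2)).

Local Notation coef := (@coef R).
Local Notation dsum := (@dsum R).

Lemma c0P (x : nat -> R^o) : c0 x <-> to0 x.
Proof.
split=> [/cvgrPdist_le h e /h[n0 _ hn]|h].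
  by exists n0 => n /hn /=; rewrite sub0r normrN.
apply/cvgrPdist_le => e /h[n0 hn]; exists n0 => // n /hn /=.
by rewrite sub0r normrN.
Qed.

Lemma c0_finsupp (x : nat -> R^o) m : (forall n, (m <= n)%N -> x n = 0) -> c0 x.
Proof.
move=> xm; apply/c0P => e e0; exists m => n /xm ->.
by rewrite normr0 ltW.
Qed.

Lemma c0D (x y : nat -> R^o) : c0 x -> c0 y -> c0 (x + y).
Proof. by move=> /c0P x0 /c0P y0; apply/c0P; exact: to0D. Qed.

Lemma jl_data0 (x : nat -> R^o) (N : 'I_0 -> set nat) : c0 x -> jl_data F x N.
Proof. by split=> // -[]. Qed.

Lemma jl_sum0 (x : nat -> R^o) (N : 'I_0 -> set nat) (a : 'I_0 -> R) :
  jl_sum x N a = x.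
Proof. by apply/funext => n; rewrite /jl_sum big_ord0 addr0. Qed.

Lemma span_c0 (x : nat -> R^o) : c0 x -> jl_span F x.
Proof.
move=> x0; exists x, 0%N, (fun=> set0), (fun=> 0).
by rewrite jl_sum0; split=> //; exact: jl_data0.
Qed.

Lemma span_ind A : F A -> jl_span F (\1_A : nat -> R^o).
Proof.
move=> FA; exists 0, 1%N, (fun=> A), (fun=> 1); split.
  split=> //; first by apply: (@c0_finsupp _ 0).
  by move=> i j _; rewrite !ord1.
by apply/funext => n; rewrite /jl_sum big_ord1 mul1r add0r.
Qed.

Lemma iota0 : iota 0 = 0.
Proof.
have c00 : c0 (0 : nat -> R^o) by apply: (@c0_finsupp _ 0).
have := iota_lin 1 (span_c0 c00) (span_c0 c00).
rewrite !scale1r addr0 => /eqP; rewrite -subr_eq subrr => /eqP.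
by move=> <-.
Qed.

Lemma iota_sum (x : nat -> R^o) k (N : 'I_k -> set nat) (a : 'I_k -> R) :
  jl_data F x N ->
  iota (jl_sum x N a) = iota x + \sum_(r < k) a r *: iota \1_(N r).
Proof.
elim: k N a => [|k IH] N a [x0 Ninj FN].
  by rewrite jl_sum0 big_ord0 addr0.
pose N' r := N (widen_ord (leqnSn k) r); pose a' r := a (widen_ord (leqnSn k) r).
have d' : jl_data F x N'.
  split=> // [i j /Ninj /(congr1 val) /= ij|r]; [exact: val_inj|exact: FN].
have -> : jl_sum x N a = a ord_max *: (\1_(N ord_max) : nat -> R^o) + jl_sum x N' a'.
  apply/funext => n; rewrite /jl_sum big_ord_recr /= addrA addrC.
  by congr (_ + _).
rewrite iota_lin; last 2 first.
- exact: span_ind.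
- by exists x, k, N', a'.
by rewrite IH // big_ord_recr /= [LHS]addrC -addrA.
Qed.

Definition unit_vec k : X := iota \1_[set k].
Definition chi A : X := iota \1_A.

Lemma iota_fin (s : nat -> R) m :
  iota (fun k => if (k < m)%N then s k else 0) = \sum_(k < m) s k *: unit_vec k.
Proof.
elim: m => [|m IH].
  by rewrite big_ord0 -[RHS]iota0; congr iota; apply/funext.
have -> : (fun k => if (k < m.+1)%N then s k else 0) =
    s m *: (\1_[set m] : nat -> R^o) + (fun k => if (k < m)%N then s k else 0).
  apply/funext => k; rewrite ltnS leq_eqVlt.
  have -> : (s m *: (\1_[set m] : nat -> R^o) + (fun k => if (k < m)%N then s k else 0)) k
     = s m * \1_[set m] k + (if (k < m)%N then s k else 0) by [].
  rewrite indicE; have [->|km] := eqVneq k m.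
    by rewrite ltnn addr0 mem_set // mulr1.
  by rewrite memNset ?mulr0 ?add0r // => /eqP; apply/negP.
rewrite iota_lin; last 2 first.
- apply: span_c0; apply: (@c0_finsupp _ m.+1) => n mn.
  by rewrite indicE memNset // => nm; rewrite nm ltnn in mn.
- by apply/span_c0/(@c0_finsupp _ m) => n; rewrite leqNgt => /negbTE ->.
by rewrite IH big_ord_recr /= addrC.
Qed.

Lemma sup_norm_le (f : nat -> R^o) b : (forall n, `|f n| <= b) -> sup_norm f <= b.
Proof.
move=> fb; apply: ge_sup; first by exists `|f 0%N|, 0%N.
by move=> _ [n _ <-].
Qed.

Lemma iota_norm_le (x : nat -> R^o) k (N : 'I_k -> set nat) (a : 'I_k -> R) b :
  jl_data F x N -> (forall n, `|jl_sum x N a n| <= b) ->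
  Num.sqrt (\sum_(r < k) a r ^+ 2) <= b -> `|iota (jl_sum x N a)| <= b.
Proof. by move=> d fb ab; rewrite iota_norm // ge_max sup_norm_le. Qed.

Lemma iota_c0_le (x : nat -> R^o) b : c0 x -> 0 <= b -> (forall n, `|x n| <= b) ->
  `|iota x| <= b.
Proof.
move=> x0 b0 xb; rewrite -(jl_sum0 x (fun=> set0) (fun=> 0)).
apply: iota_norm_le; first exact: jl_data0.
  by rewrite jl_sum0.
by rewrite big_ord0 sqrtr0.
Qed.

(** Norm at most [M], as an inequality, so that combinations of functionals are estimated without
    suprema. *)
Definition bdd_functional (M : R) (u : X -> R) :=
  [/\ 0 <= M, forall (c : R) p q, u (c *: p + q) = c * u p + u q &
    forall p, `|u p| <= M * `|p|].

Section Functional.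
Variables (M : R) (u : X -> R).
Hypothesis uM : bdd_functional M u.

Lemma functional0 : u 0 = 0.
Proof.
have [_ ul _] := uM; have := ul 1 0 0; rewrite scale1r addr0 mul1r => /eqP.
by rewrite -subr_eq subrr => /eqP.
Qed.

Lemma functionalD p q : u (p + q) = u p + u q.
Proof. by have [_ ul _] := uM; rewrite -[p]scale1r ul mul1r scale1r. Qed.

Lemma functionalZ c p : u (c *: p) = c * u p.
Proof. by have [_ ul _] := uM; rewrite -[c *: p]addr0 ul functional0 addr0. Qed.

Lemma functional_sum k (a : 'I_k -> R) (p : 'I_k -> X) :
  u (\sum_(r < k) a r *: p r) = \sum_(r < k) a r * u (p r).
Proof.
elim/big_ind2: _ => [|x y z t <- <-|r _]; [exact: functional0| |exact: functionalZ].
exact: functionalD.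
Qed.

(** Tested on the signs of the first [K] values, a vector of [c0] of norm at most 1. *)
Lemma functional_l1 : l1 M (fun k => u (unit_vec k)).
Proof.
have [M0 _ ub] := uM => K; pose s k := Num.sg (u (unit_vec k)).
have -> : \sum_(k < K) `|u (unit_vec k)| =
    u (iota (fun k => if (k < K)%N then s k else 0)).
  rewrite iota_fin functional_sum; apply: eq_bigr => k _.
  by rewrite normrEsg.
rewrite (le_trans (ler_norm _)) // (le_trans (ub _)) // ler_piMr //.
apply: iota_c0_le => // [|n].
  by apply: (@c0_finsupp _ K) => n; rewrite leqNgt => /negbTE ->.
case: ifP => _; last by rewrite normr0.
by rewrite /s normr_sg; case: (_ == _).
Qed.

End Functional.

(* coord u is the l1-component of u and l2_part u its l2(F)-component. *)
Definition coord (u : X -> R) k := u (unit_vec k).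

Definition l2_part (u : X -> R) A := u (chi A) - ssum (coord u) A.

Hypothesis adF : almost_disjoint F.

(** Test [u] on the combination of the [\1_(N r)] with coefficients [a r = l2_part u (N r)], its
    first [m] coordinates cancelled by [x]. Past [m0] the sets are disjoint, so the sup norm is at
    most the l2 norm [sqrt S] of [a]. As [m] grows the value of [u] tends to [S], whence
    [S <= M * sqrt S]. *)
Lemma l2_part_bessel M u (G : seq (set nat)) : bdd_functional M u ->
  uniq G -> (forall A, A \in G -> F A) -> \sum_(A <- G) l2_part u A ^+ 2 <= M ^+ 2.
Proof.
move=> uM Gu GF; have [M0 ul ub] := uM.
pose k := size G; pose N (r : 'I_k) := nth set0 G r.
pose a (r : 'I_k) := l2_part u (N r).
have -> : \sum_(A <- G) l2_part u A ^+ 2 = \sum_(r < k) a r ^+ 2.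
  by rewrite (big_nth set0) big_mkord.
set S := \sum_(r < k) _.
have FN r : F (N r) by apply: GF; exact: mem_nth.
have Ninj : injective N.
  by move=> r s /eqP; rewrite nth_uniq // => /eqP; exact: val_inj.
have /choice[mm mmP] (rs : 'I_k * 'I_k) : exists m, rs.1 != rs.2 ->
    forall n, (N rs.1 `&` N rs.2) n -> (n < m)%N.
  have [_|rs0] := eqVneq rs.1 rs.2; first by exists 0%N.
  have [//|m mP] := @finite_set_nat_ub (N rs.1 `&` N rs.2).
    by apply: adF.2 => // /Ninj; apply/eqP.
  by exists m.
pose m0 := \max_(r < k) \max_(s < k) mm (r, s).
have disj n r s : (m0 <= n)%N -> N r n -> N s n -> r = s.
  move=> mn rn sn; apply/eqP/negPn/negP => /(mmP (r, s)) /(_ n (conj rn sn)) /=.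
  rewrite ltnNge (leq_trans _ mn) //.
  by apply: leq_trans (leq_bigmax r); exact: (leq_bigmax s).
have S0 : 0 <= S by apply: sumr_ge0 => r _; exact: sqr_ge0.
have key m : (m0 <= m)%N ->
    \sum_(r < k) a r * (u (chi (N r)) - psum (coord u) (N r) m) <= M * Num.sqrt S.
  move=> m0m; pose s n := - \sum_(r < k) a r * \1_(N r) n.
  pose x : nat -> R^o := fun n => if (n < m)%N then s n else 0.
  have dx : jl_data F x N.
    by split=> //; apply: (@c0_finsupp _ m) => n; rewrite /x leqNgt => /negbTE ->.
  have -> : \sum_(r < k) a r * (u (chi (N r)) - psum (coord u) (N r) m) =
      u (iota (jl_sum x N a)).
    rewrite iota_sum // (functionalD uM) iota_fin !(functional_sum uM).
    rewrite addrC; under eq_bigr do rewrite mulrBr.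
    rewrite sumrB; congr (_ + _).
    under [in RHS]eq_bigr do rewrite /s mulNr mulr_suml.
    rewrite sumrN exchange_big /=; congr (- _); apply: eq_bigr => r _.
    rewrite mulr_sumr; apply: eq_bigr => n _; rewrite /coord; ring.
  rewrite (le_trans (ler_norm _)) // (le_trans (ub _)) // ler_wpM2l //.
  apply: iota_norm_le => // n; rewrite /jl_sum /x.
  have [nm|mn] := ltnP n m; first by rewrite /s addNr normr0 sqrtr_ge0.
  rewrite add0r; have [[r0 r0n]|nr] := pselect (exists r, N r n); last first.
    rewrite big1 ?normr0 ?sqrtr_ge0 // => r _.
    by rewrite indicE memNset ?mulr0 // => Nr; apply: nr; exists r.
  rewrite (bigD1 r0) //= big1 ?addr0 => [|r rr0].
    rewrite indicE mem_set // mulr1 -sqrtr_sqr ler_sqrt //.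
    by rewrite /S (bigD1 r0) //= lerDl sumr_ge0 // => r _; exact: sqr_ge0.
  rewrite indicE memNset ?mulr0 // => Nr; move/eqP: rr0; apply.
  by apply: disj Nr r0n; exact: leq_trans mn.
have SM : S <= M * Num.sqrt S.
  (* The error made in replacing the sums over the [N r] by their partial sums up to [m]. *)
  pose w m := \sum_(r < k) a r * (psum (coord u) (N r) m - ssum (coord u) (N r)).
  apply: (@to0_le_of _ w).
    rewrite /w; apply: to0_sum => r.
    have := to0Z (- a r) (ssumP (N r) (functional_l1 uM)).
    by apply: to0_le => n; rewrite mulNr -mulrN opprB.
  exists m0 => m /key h; suff SE : S =
      \sum_(r < k) a r * (u (chi (N r)) - psum (coord u) (N r) m) + w m.
    by rewrite {1}SE lerD2r.
  rewrite /w -big_split /=; apply: eq_bigr => r _.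
  by rewrite -mulrDr addrA subrK -expr2.
have q0 := sqrtr_ge0 S; have qS := sqr_sqrtr S0.
have [qM|Mq] := lerP (Num.sqrt S) M; first by rewrite -qS lerXn2r // nnegrE.
by move: SM; rewrite -[leLHS]qS expr2 leNgt ltr_pM2r ?Mq // (le_lt_trans M0).
Qed.


Lemma functional_lin M N u v a : bdd_functional M u -> bdd_functional N v ->
  bdd_functional (`|a| * M + N) (fun p => a * u p + v p).
Proof.
move=> [M0 ul ub] [N0 vl vb]; split.
- by rewrite addr_ge0 // mulr_ge0.
- by move=> c p q; rewrite ul vl; ring.
- move=> p; rewrite (le_trans (ler_normD _ _)) // mulrDl lerD // normrM -mulrA.
  by rewrite ler_wpM2l.
Qed.

Lemma l2_part_lin M N u v a A : bdd_functional M u -> bdd_functional N v ->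
  l2_part (fun p => a * u p + v p) A = a * l2_part u A + l2_part v A.
Proof.
move=> /functional_l1 hu /functional_l1 hv; rewrite /l2_part.
have -> : ssum (coord (fun p => a * u p + v p)) A =
    a * ssum (coord u) A + ssum (coord v) A by exact: ssum_lin hu hv.
ring.
Qed.

(** By the Bessel-type bound, each threshold [1/(n+1)] is exceeded at only finitely many members of
    [F]. *)
Lemma l2_part_countable M u : bdd_functional M u ->
  countable [set A | F A /\ l2_part u A <> 0].
Proof.
move=> uM; pose E n := [set A | F A /\ n.+1%:R^-1 < `|l2_part u A|].
apply: (@sub_countable _ _ _ (\bigcup_n E n)).
  apply: subset_card_le => A [FA /eqP]; rewrite -normr_gt0 => /to0_pos_inv[n hn].
  by exists n.
apply: bigcup_countable => // n _; apply: finite_set_countable.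
apply: contrapT => /infiniteP/pcard_leP/injfunPex[f fE /in2TT finj].
pose q : R := n.+1%:R^-1 ^+ 2.
have q0 : 0 < q by rewrite exprn_gt0.
pose p := Num.bound (M ^+ 2 / q); pose G := map f (seq.iota 0 p).
have Gu : uniq G by rewrite map_inj_uniq ?iota_uniq.
have GF A : A \in G -> F A by move=> /mapP[i _ ->]; have [] := fE i I.
have := l2_part_bessel uM Gu GF; apply/negP; rewrite -ltNge.
apply: (@lt_le_trans _ _ (p%:R * q)).
  by rewrite -ltr_pdivrMr // archi_boundP // divr_ge0 ?sqr_ge0 ?(ltW q0).
have -> : p%:R * q = \sum_(A <- G) q.
  by rewrite big_const_seq count_predT iter_addr_0 size_map size_iota mulr_natl.
rewrite big_seq [leRHS]big_seq; apply: ler_sum => _ /mapP[i _ ->].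
have [_ /ltW h] := fE i I.
by rewrite -[leRHS]real_normK ?num_real // lerXn2r // nnegrE.
Qed.

(* A family of convex sets clustering at [phi] contains sets [Cn n], still
   clustering at [phi], on which the l2(F)-component is almost constant: take
   the functionals that nearly minimize its norm and use the parallelogram
   law. *)
Lemma cluster_l2_part (C : set (X -> R)) M phi :
  (forall u, C u -> bdd_functional M u) ->
  (forall u v, C u -> C v -> C (fun p => 2^-1 * u p + 2^-1 * v p)) ->
  (forall (s : seq X) e, 0 < e -> exists2 u, C u &
     forall p, p \in s -> `|u p - phi p| <= e) ->
  exists (Cn : nat -> set (X -> R)) (t : set nat -> R),
  [/\ forall n, Cn n `<=` C,
    forall n (s : seq X) e, 0 < e -> exists2 u, Cn n u &
      forall p, p \in s -> `|u p - phi p| <= e &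
    forall n u A, Cn n u -> F A -> `|l2_part u A - t A| <= 2 * n.+1%:R^-1].
Proof.
move=> CM Cmid Cphi.
pose FG (G : seq (set nat)) := uniq G /\ forall A, A \in G -> F A.
(* [Q u] is the squared norm of the l2(F)-component, as a supremum over finite subfamilies. *)
pose E u := [set \sum_(A <- G) l2_part u A ^+ 2 | G in FG].
pose Q u := sup (E u).
have Eub u : C u -> ubound (E u) (M ^+ 2).
  by move=> Cu _ [G [Gu GF] <-]; apply: l2_part_bessel => //; exact: CM.
have E0 u : E u !=set0.
  by exists (\sum_(A <- [::]) l2_part u A ^+ 2); exists [::].
have Esup u : C u -> has_sup (E u).
  by move=> Cu; split=> //; exists (M ^+ 2); exact: Eub.
have leQ u G : C u -> FG G -> \sum_(A <- G) l2_part u A ^+ 2 <= Q u.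
  by move=> Cu GF; apply: ub_le_sup; [exists (M ^+ 2); exact: Eub|exists G].
pose CV (s : seq X) (e : R) := [set u | C u /\ forall p, p \in s -> `|u p - phi p| <= e].
(* The supremum [ds] of [D] is the lower limit of [Q] at [phi] along [C]. *)
pose D := [set d | exists s e, 0 < e /\ forall u, CV s e u -> d <= Q u].
have Dsup : has_sup D.
  split.
    exists 0, [::], 1; split=> // u [Cu _].
    by have := leQ u [::] Cu; rewrite big_nil; apply.
  exists (M ^+ 2) => d [s [e [e0 h]]].
  have [u Cu us] := Cphi s e e0; apply: (le_trans (h u (conj Cu us))).
  by apply: ge_sup => //; exact: Eub.
(* The 12: for [u], [v] in [Cn n] with midpoint [w], take a finite subfamily losing at most [dl n]
   of [Q w]. The parallelogram law bounds the squared distance by [4 (ds + dl n) - 4 (ds - 2 dl n) =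
   12 dl n]. *)
pose ds := sup D; pose dl n : R := (n.+1%:R^-1) ^+ 2 / 12.
have dl0 n : 0 < dl n by rewrite divr_gt0 ?exprn_gt0.
have dlle m n : (m <= n)%N -> dl n <= dl m.
  move=> mn; rewrite ler_wpM2r // lerXn2r ?nnegrE //.
  by rewrite lef_pV2 ?posrE // ler_nat.
have /choice[V VP] n : exists se : seq X * R, 0 < se.2 /\
    forall u, CV se.1 se.2 u -> ds - dl n <= Q u.
  have [d [s [e [e0 h]]] hd] := sup_adherent (dl0 n) Dsup.
  by exists (s, e); split=> // u /h; apply: le_trans; exact: ltW.
have near s e n : 0 < e -> exists2 u, CV s e u & Q u < ds + dl n.
  move=> e0; apply: contrapT => nu.
  have : ds + dl n <= ds.
    apply: sup_upper_bound => //; exists s, e; split=> // u su.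
    by rewrite leNgt; apply/negP => h; apply: nu; exists u.
  by rewrite leNgt ltrDl dl0.
pose Cn n := [set u | CV (V n).1 (V n).2 u /\ Q u < ds + dl n].
have close n u v A : Cn n u -> Cn n v -> F A ->
    `|l2_part u A - l2_part v A| <= n.+1%:R^-1.
  move=> [[Cu us] uQ] [[Cv vs] vQ] FA.
  pose w p := 2^-1 * u p + 2^-1 * v p.
  have Cw : C w by exact: Cmid.
  have rw B : l2_part w B = 2^-1 * l2_part u B + 2^-1 * l2_part v B.
    have f0 : bdd_functional M (fun p => 2^-1 * v p).
      have [M0 vl vb] := CM v Cv; split=> // [c p q|p]; first by rewrite vl; ring.
      rewrite normrM (le_trans _ (vb p)) // ler_piMl //.
      by rewrite ger0_norm ?invr_ge0 // invf_le1 // ler1n.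
    rewrite (l2_part_lin _ _ (CM u Cu) f0); congr (_ + _).
    have f00 : bdd_functional 0 (fun _ : X => 0 : R).
      by split=> // [c p q|p]; rewrite ?mulr0 ?addr0 // normr0 mul0r.
    have r0 : l2_part (fun=> 0) B = 0.
      rewrite /l2_part sub0r; apply/eqP; rewrite oppr_eq0 -normr_le0.
      exact: ssum_le (functional_l1 f00).
    have := l2_part_lin 2^-1 B (CM v Cv) f00; rewrite r0 addr0 => <-.
    by congr l2_part; apply/funext => p; rewrite addr0.
  have Qw : ds - dl n <= Q w.
    apply: (VP n).2; split=> // p ps.
    have -> : w p - phi p = 2^-1 * (u p - phi p) + 2^-1 * (v p - phi p).
      by rewrite /w; field.
    have := us p ps; have := vs p ps; rewrite !ler_norml; lra.
  have [_ [G [Gu GF] <-] hG] := sup_adherent (dl0 n) (Esup w Cw).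
  (* Adding [A] makes the difference at [A] one of the terms of the sum. *)
  pose G' := if A \in G then G else A :: G.
  have AG' : A \in G'.
    by rewrite /G'; case: ifP => // _; rewrite inE eqxx.
  have FG' : FG G'.
    rewrite /G'; case: ifP => // /negbT AG; split=> /=; first by rewrite AG.
    by move=> B; rewrite inE => /orP[/eqP->//|/GF].
  have hG' : \sum_(B <- G) l2_part w B ^+ 2 <= \sum_(B <- G') l2_part w B ^+ 2.
    by rewrite /G'; case: ifP => // _; rewrite big_cons lerDr sqr_ge0.
  have par : \sum_(B <- G') (l2_part u B - l2_part v B) ^+ 2 =
      2 * \sum_(B <- G') l2_part u B ^+ 2 + 2 * \sum_(B <- G') l2_part v B ^+ 2
      - 4 * \sum_(B <- G') l2_part w B ^+ 2.
    rewrite !mulr_sumr -sumrN -!big_split /=; apply: eq_bigr => B _.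
    by rewrite rw; field.
  have leS : (l2_part u A - l2_part v A) ^+ 2 <=
      \sum_(B <- G') (l2_part u B - l2_part v B) ^+ 2.
    rewrite (big_rem A) //= lerDl sumr_ge0 // => B _; exact: sqr_ge0.
  have : `|l2_part u A - l2_part v A| ^+ 2 <= n.+1%:R^-1 ^+ 2.
    rewrite real_normK ?num_real // (le_trans leS) // par.
    have := leQ u G' Cu FG'; have := leQ v G' Cv FG'.
    move: hG; rewrite -/(Q w).
    have -> : n.+1%:R^-1 ^+ 2 = 12 * dl n by rewrite /dl; field.
    lra.
  by rewrite ler_pXn2r // nnegrE.
have common n m : exists2 w, Cn n w & Cn m w.
  have [|w [Cw ws] wQ] := near ((V n).1 ++ (V m).1)
    (Num.min (V n).2 (V m).2) (maxn n m).
    by rewrite lt_min (VP n).1 (VP m).1.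
  have wn p : p \in (V n).1 -> `|w p - phi p| <= (V n).2.
    move=> ps; have := ws p; rewrite mem_cat ps le_min => /(_ isT)/andP[]//.
  have wm p : p \in (V m).1 -> `|w p - phi p| <= (V m).2.
    move=> ps; have := ws p; rewrite mem_cat ps orbT le_min => /(_ isT)/andP[]//.
  exists w; (split; first by split); rewrite (lt_le_trans wQ) // lerD2l.
    by rewrite dlle // leq_maxl.
  by rewrite dlle // leq_maxr.
have close2 n m u v A : Cn n u -> Cn m v -> F A ->
    `|l2_part u A - l2_part v A| <= n.+1%:R^-1 + m.+1%:R^-1.
  move=> Cu Cv FA; have [w Cnw Cmw] := common n m.
  rewrite -(subrK (l2_part w A) (l2_part u A)) -addrA.
  rewrite (le_trans (ler_normD _ _)) // lerD //.
    exact: close.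
  exact: close.
have /choice[uu uuP] n : exists u, Cn n u by have [w] := common n n; exists w.
(* The limit of [l2_part (uu n) A], obtained as the supremum of its lower estimates. *)
pose T A := [set l2_part (uu n) A - n.+1%:R^-1 | n in [set: nat]].
have Tub n u A : Cn n u -> F A -> ubound (T A) (l2_part u A + n.+1%:R^-1).
  move=> Cu FA _ [m _ <-]; have := close2 _ _ _ _ _ (uuP m) Cu FA.
  rewrite ler_norml => /andP[_].
  by move: (m.+1%:R^-1) (n.+1%:R^-1) => a b; lra.
exists Cn, (fun A => sup (T A)); split.
- by move=> n u [[]].
- move=> n s e e0.
  have [|w [Cw ws] wQ] := near ((V n).1 ++ s) (Num.min (V n).2 e) n.
    by rewrite lt_min (VP n).1 e0.
  exists w.
    split=> //; split=> // p ps.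
    by have := ws p; rewrite mem_cat ps le_min => /(_ isT)/andP[].
  move=> p ps.
  by have := ws p; rewrite mem_cat ps orbT le_min => /(_ isT)/andP[].
- move=> n u A Cu FA.
  have h1 : sup (T A) <= l2_part u A + n.+1%:R^-1.
    by apply: ge_sup; [exists (l2_part (uu 0%N) A - 1%:R^-1), 0%N|exact: Tub].
  have h2 : l2_part (uu n) A - n.+1%:R^-1 <= sup (T A).
    by apply: ub_le_sup; [exists (l2_part u A + n.+1%:R^-1); exact: Tub|exists n].
  have := close _ _ _ _ (uuP n) Cu FA.
  have : 0 < n.+1%:R^-1 :> R by rewrite invr_gt0.
  rewrite !ler_norml; move: (n.+1%:R^-1) h1 h2 => r; lra.
Qed.

Lemma avg_near2 (T : eqType) (L : seq T) (g h : T -> R) (a e : R) :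
  (0 < size L)%N -> {in L, forall d, `|g d - a - h d| <= e} ->
  `|avg L g - a - avg L h| <= e.
Proof.
move=> L0 gh; have -> : avg L g - a - avg L h = avg L (fun d => g d - h d) - a.
  by rewrite /avg sumrB mulrBl addrAC.
by apply: avg_near => // d /gh; rewrite addrAC.
Qed.

Lemma to0_near (g h r : nat -> R) :
  to0 h -> to0 r -> (forall n, `|g n - h n| <= r n) -> to0 g.
Proof.
move=> h0 r0 gh.
have : to0 (fun n => h n + (g n - h n)).
  apply: to0D => //; apply: to0_le r0 => n.
  by rewrite (le_trans (gh n)) // ler_norm.
by apply: to0_le => n; rewrite addrC subrK.
Qed.

Lemma convex_avg (C : set (X -> R)) (T : eqType) (L : seq T) (g : T -> X -> R) :
  (forall u v t, C u -> C v -> 0 <= t <= 1 ->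
    C (fun p => t * u p + (1 - t) * v p)) ->
  (0 < size L)%N -> {in L, forall d, C (g d)} ->
  C (fun p => avg L (g^~ p)).
Proof.
move=> convC; elim: L => // d [|d' L] IH _ LC.
  have -> : (fun p => avg [:: d] (g^~ p)) = g d.
    by apply/funext => p; rewrite /avg big_seq1 divr1.
  by apply: LC; rewrite inE.
have -> : (fun p => avg [:: d, d' & L] (g^~ p)) = fun p =>
    (size (d' :: L)).+1%:R^-1 * g d p +
    (1 - (size (d' :: L)).+1%:R^-1) * avg (d' :: L) (g^~ p).
  apply/funext => p; rewrite /avg big_cons; move: (\sum_(_ <- _) _) => S.
  rewrite [size _]/=; set s := (size L).+1.
  have s0 : s%:R != 0 :> R by rewrite pnatr_eq0.
  rewrite -[s.+1%:R]natr1 [size _]/=  -/s; field.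
  by rewrite s0 natr1 pnatr_eq0.
apply: convC.
- by apply: LC; rewrite inE eqxx.
- by apply: IH => // x xL; apply: LC; rewrite inE xL orbT.
- by rewrite invr_ge0 ler0n /= invf_le1 // ler1n.
Qed.

(** For [u] in [Cn n], the number [u (chi A) - phi (chi A)] is the sum of [coord u - coord phi] over
    [A] minus [t A], up to [2/(n+1)]. Replacing that l1 vector by a rational one gives an instance
    of [answering], whose averages are then transferred to functionals. *)
Lemma answering_sequence (C : set (X -> R)) M phi Mphi :
  @answering R F ->
  (forall u, C u -> bdd_functional M u) -> bdd_functional Mphi phi ->
  (forall u v t, C u -> C v -> 0 <= t <= 1 ->
    C (fun p => t * u p + (1 - t) * v p)) ->
  (forall (s : seq X) e, 0 < e -> exists2 u, C u &
     forall p, p \in s -> `|u p - phi p| <= e) ->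
  exists v : nat -> X -> R, [/\ forall n, C (v n),
    forall k, to0 (fun n => v n (unit_vec k) - phi (unit_vec k)) &
    forall A, F A -> to0 (fun n => v n (chi A) - phi (chi A))].
Proof.
move=> ans CM phiM convC Cphi.
have [|Cn [t0 [CnC Cncl Cnres]]] := cluster_l2_part CM _ Cphi.
  move=> u v Cu Cv; have := convC u v 2^-1 Cu Cv.
  rewrite (_ : 1 - 2^-1 = 2^-1); last by field.
  by apply; rewrite invr_ge0 ler0n /= invf_le1 // ler1n.
(* The 3 is 2 from [Cnres] plus 1 for the remaining approximations. *)
pose t A := l2_part phi A - t0 A; pose r n : R := 3 * n.+1%:R^-1.
pose D n := [set d | exists2 u, Cn n u &
  l1 n.+1%:R^-1 (fun k => coord u k - coord phi k - coef d k)].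
have phil1 := functional_l1 phiM.
have ul1 n u : Cn n u -> l1 M (coord u) by move=> /CnC/CM/functional_l1.
have /choice[uu uuP] n : exists u, Cn n u.
  by have [u Cu _] := Cncl n [::] 1 ltr01; exists u.
(* [t0 A] is the limit of [l2_part (uu n) A], so [t] vanishes wherever [phi] and all the [uu n] have
   l2-component 0. *)
have tc : countable [set A | F A /\ t A <> 0].
  apply: (@sub_countable _ _ _ ([set A | F A /\ l2_part phi A <> 0] `|`
    \bigcup_n [set A | F A /\ l2_part (uu n) A <> 0])); last first.
    apply: countable_setU; first exact: l2_part_countable phiM.
    by apply: bigcup_countable => // n _; apply: (@l2_part_countable M); exact/CM/CnC.
  apply: subset_card_le => A [FA tA]; apply: contrapT => nA; apply: tA.
  have phi0 : l2_part phi A = 0 by apply: contrapT => h; apply: nA; left.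
  have uu0 n : l2_part (uu n) A = 0.
    by apply: contrapT => h; apply: nA; right; exists n.
  rewrite /t phi0 sub0r; apply: to0_eq0.
  apply: to0_le (to0Z 2 (@to0_inv R)) => n.
  have := Cnres n _ A (uuP n) FA; rewrite uu0 sub0r => h.
  by rewrite (le_trans h) // ler_norm.
have DN n u d A b : Cn n u -> F A ->
    l1 b (fun k => coord u k - coord phi k - coef d k) ->
    `|u (chi A) - phi (chi A) - (dsum d A - t A)| <= b + 2 * n.+1%:R^-1.
  move=> Cu FA hl; have h1 := Cnres n u A Cu FA.
  have h2 := ssum_le A hl.
  have e : ssum (fun k => coord u k - coord phi k - coef d k) A =
      ssum (coord u) A - ssum (coord phi) A - dsum d A.
    rewrite -ssum_coef; have hd := @l1_coef R d; have hu := ul1 n u Cu.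
    have := ssum_lin (-1) A hd (l1B hu phil1).
    have := ssum_lin (-1) A phil1 hu.
    rewrite (_ : (fun k => -1 * coord phi k + coord u k) =
      fun k => coord u k - coord phi k); last by apply/funext => k; ring.
    move=> ->; rewrite (_ : (fun k => -1 * coef d k + (coord u k - coord phi k)) =
      fun k => coord u k - coord phi k - coef d k); last by apply/funext => k; ring.
    by move=> ->; ring.
  rewrite e in h2.
  rewrite (_ : u (chi A) - phi (chi A) - (dsum d A - t A) =
    (ssum (coord u) A - ssum (coord phi) A - dsum d A) + (l2_part u A - t0 A)).
    by rewrite (le_trans (ler_normD _ _)) // lerD.
  by rewrite /t /l2_part; ring.
have Dap n : approx (D n) t (r n) F.
  move=> G K e GF e0.
  have n0 : 0 < n.+1%:R^-1 :> R by rewrite invr_gt0.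
  (* Half of each tolerance goes to the closeness of [u] to [phi], half to rational
     approximation. *)
  pose eta := Num.min (e / 2) (n.+1%:R^-1 / 2).
  have eta0 : 0 < eta by rewrite lt_min !divr_gt0.
  have eta1 : eta <= e / 2 by rewrite ge_min lexx.
  have eta2 : eta <= n.+1%:R^-1 / 2 by rewrite ge_min lexx orbT.
  have [u Cu us] := Cncl n ([seq unit_vec k | k <- seq.iota 0 K] ++ map chi G) _ eta0.
  have [d dl] := l1_rat_dense (l1B (ul1 n u Cu) phil1) eta0.
  have dl' : l1 n.+1%:R^-1 (fun k => coord u k - coord phi k - coef d k).
    move=> K'; rewrite (le_trans (dl K')) // (le_trans eta2) //.
    by rewrite ler_piMr ?ltW // invf_lt1 // ltr1n.
  exists d; split.
  - by exists u.
  - move=> k kK; have h1 : `|coord u k - coord phi k - coef d k| <= eta := l1_le k dl.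
    have h2 : `|coord u k - coord phi k| <= eta.
      by apply: us; rewrite mem_cat map_f // mem_iota.
    move: eta eta1 h1 h2 {eta0 eta2 us dl dl'} => eta eta1.
    rewrite !ler_norml => /andP[? ?] /andP[? ?].
    by apply/andP; split; lra.
  - move=> A AG; have := DN n u d A _ Cu (GF _ AG) dl.
    have h1 : `|u (chi A) - phi (chi A)| <= eta.
      by apply: us; rewrite mem_cat map_f ?orbT.
    move: h1 eta2; rewrite !ler_norml /r.
    move: (n.+1%:R^-1) => a /andP[? ?] ? /andP[? ?].
    by apply/andP; split; lra.
have r0 : to0 r by exact: to0Z (@to0_inv R).
have Dbd n d : D n d -> forall k, `|coef d k| <= M + Mphi + 1.
  move=> [u Cu dl] k; 
  have h1 : `|coord u k - coord phi k - coef d k| <= n.+1%:R^-1 := l1_le k dl.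
  have h2 : `|coord u k| <= M := l1_le k (ul1 n u Cu).
  have h3 : `|coord phi k| <= Mphi := l1_le k phil1.
  have h4 : n.+1%:R^-1 <= 1 :> R by rewrite invf_le1 // ler1n.
  move: h1 h2 h3 h4; rewrite !ler_norml; move: (n.+1%:R^-1) => a.
  by move=> /andP[? ?] /andP[? ?] /andP[? ?] ?; apply/andP; split; lra.
have [L [LD LF Lk]] := ans D t r _ r0 tc Dap Dbd.
(* Each rational vector is traced back to a functional of [Cn n] that it approximates; convexity
   keeps the averages of these in [C]. *)
have /choice[ud udP] (nd : nat * seq rat) : exists u, D nd.1 nd.2 ->
    Cn nd.1 u /\ l1 nd.1.+1%:R^-1 (fun k => coord u k - coord phi k - coef nd.2 k).
  have [[u Cu ul]|nD] := pselect (D nd.1 nd.2); first by exists u.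
  by exists (fun=> 0) => /nD.
have udC n d : d \in L n -> Cn n (ud (n, d)).
  by move=> /(LD n).2 /(udP (n, d)) [].
have udl n d : d \in L n ->
    l1 n.+1%:R^-1 (fun k => coord (ud (n, d)) k - coord phi k - coef d k).
  by move=> /(LD n).2 /(udP (n, d)) [].
exists (fun n p => avg (L n) (fun d => ud (n, d) p)); split.
- move=> n; apply: (@convex_avg C _ (L n) (fun d => ud (n, d))) => //.
    by have [] := LD n.
  by move=> d /udC/CnC.
- move=> k; apply: to0_near (Lk k) (@to0_inv R) _ => n.
  apply: avg_near2; first by have [] := LD n.
  by move=> d /udl /(l1_le k).
- move=> A FA; apply: to0_near (LF A FA) r0 _ => n.
  set x := avg _ _; set y := avg _ _.
  rewrite (_ : x - phi (chi A) - (y - t A) = x - (phi (chi A) - t A) - y).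
    apply: avg_near2; first by have [] := LD n.
    move=> d dL; have := DN n _ d A _ (udC n d dL) FA (udl n d dL).
    rewrite (_ : _ - (dsum d A - t A) = ud (n, d) (chi A) -
      (phi (chi A) - t A) - dsum d A); last by ring.
    by move=> h; rewrite (le_trans h) // /r; move: (n.+1%:R^-1) => a; lra.
  ring.
Qed.
End JL.

(** * From the dense span to the whole space, and property (E) *)

Section JLdense.
Variable R : realType.
Variables (F : set (set nat)) (X : completeNormedModType R).
Variable iota : (nat -> R^o) -> X.
Hypothesis iota_lin : forall (c : R) f g, jl_span F f -> jl_span F g ->
  iota (c *: f + g) = c *: iota f + iota g.
Hypothesis iota_norm : forall x k (N : 'I_k -> set nat) (a : 'I_k -> R),
  jl_data F x N -> `|iota (jl_sum x N a)| =
    Num.max (sup_norm (jl_sum x N a)) (Num.sqrt (\sum_(r < k) a r ^+ 2)).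
Hypothesis iota_dense : closure (iota @` jl_span F) = [set: X].

(** The points where the sequence tends to 0 form a subspace, closed thanks to the common bound [B].
    It contains the image of [c0] by truncation to finite combinations of unit vectors, and the
    [chi A], hence everything. *)
Lemma to0_dense (w : nat -> X -> R) (B : R) :
  (forall n, bdd_functional B (w n)) ->
  (forall k, to0 (fun n => w n (unit_vec iota k))) ->
  (forall A, F A -> to0 (fun n => w n (chi iota A))) ->
  forall p, to0 (fun n => w n p).
Proof.
move=> wB we wchi; pose Z p := to0 (fun n => w n p).
have B0 : 0 <= B by have [] := wB 0%N.
have Zlin c p q : Z p -> Z q -> Z (c *: p + q).
  move=> Zp Zq; have := to0D (to0Z c Zp) Zq; apply: to0_le => n.
  by have [_ -> _] := wB n.
have Z0 : Z 0.
  by move=> e e0; exists 0%N => n _; rewrite (functional0 (wB n)) normr0 ltW.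
have Zsum k (a : 'I_k -> R) (p : 'I_k -> X) :
    (forall r, Z (p r)) -> Z (\sum_(r < k) a r *: p r).
  move=> Zp; elim/big_ind: _ => // [x y Zx Zy|r _].
    by rewrite -[x]scale1r; exact: Zlin.
  by rewrite -[X in Z X]addr0; exact: Zlin.
have Zapprox p : (forall e, 0 < e -> exists2 q, Z q & `|p - q| <= e) -> Z p.
  move=> ap e e0; have e2 : 0 < e / 2 by rewrite divr_gt0.
  have B1 : 0 < B + 1 by rewrite ltr_wpDl.
  have [q Zq pq] := ap _ (divr_gt0 e2 B1); have [n0 h] := Zq _ e2.
  exists n0 => n /h hn; rewrite -(subrK q p) (functionalD (wB n)).
  rewrite (le_trans (ler_normD _ _)) // [leRHS]splitr lerD //.
  have [_ _ wb] := wB n; rewrite (le_trans (wb _)) //.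
  have : B * `|p - q| <= B * (e / 2 / (B + 1)) by rewrite ler_wpM2l.
  move=> /le_trans; apply; rewrite mulrA ler_pdivrMr // mulrC ler_pM2l //.
  by rewrite lerDl.
have Zc0 x : c0 x -> Z (iota x).
  move=> x0; apply: Zapprox => e e0.
  have [m xm] := (c0P x).1 x0 _ e0.
  pose y : nat -> R^o := fun k => if (k < m)%N then x k else 0.
  have y0 : c0 y by apply: (@c0_finsupp _ y m) => n; rewrite /y leqNgt => /negbTE ->.
  exists (iota y).
    by rewrite (iota_fin iota_lin); apply: Zsum => k; exact: we.
  have -> : iota x - iota y = iota (-1 *: y + x).
    rewrite iota_lin; [|exact: span_c0..].
    by rewrite scaleN1r addrC.
  apply: (iota_c0_le iota_norm) => [||n].
  - apply: c0D => //; apply: (@c0_finsupp _ _ m) => n mn.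
    by rewrite (_ : (-1 *: y) n = -1 * y n) // /y ltnNge mn mulr0.
  - exact: ltW.
  - have -> : (-1 *: y + x) n = - y n + x n by rewrite -[- y n]mulN1r.
    rewrite /y; have [nm|/xm] := ltnP n m; first by rewrite addNr normr0 ltW.
    by rewrite oppr0 add0r.
move=> p; apply: Zapprox => e e0.
have : closure (iota @` jl_span F) p by rewrite iota_dense.
move=> /(_ (ball p e)) [|_ [[f [x [k [N [a [d ->]]]]] <-]]].
  exact: nbhsx_ballx.
rewrite -ball_normE /= => /ltW h; exists (iota (jl_sum x N a)) => //.
rewrite (iota_sum iota_lin) //; case: d => x0 _ FN.
rewrite -[iota x]scale1r; apply: Zlin; first exact: Zc0.
by apply: Zsum => r; exact: wchi.
Qed.

(** Continuity bounds the set whose supremum is [dual_norm]; the inequality follows by scaling into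
    the unit ball. *)
Lemma dual_functional (u : X -> R^o) : dual u -> bdd_functional (dual_norm u) u.
Proof.
move=> [ul uc]; pose f : {linear X -> R^o} :=
  HB.pack u (GRing.isLinear.Build _ _ _ _ u ul).
have [r r0 ur] : exists2 r, 0 < r & forall x, `|u x| <= r * `|x|.
  have : bounded_near f (nbhs 0) by apply: continuous_linear_bounded; exact: uc.
  by move=> /linear_boundedP/pinfty_ex_gt0.
pose E := [set `|u x| | x in [set x : X | `|x| <= 1]].
have u0 : u 0 = 0 by exact: (linear0 f).
have E0 : E 0 by exists 0; rewrite /= ?normr0 // u0 normr0.
have Eub : has_ubound E.
  by exists r => _ [x /= x1 <-]; rewrite (le_trans (ur x)) // ler_piMr // ltW.
have M0 : 0 <= dual_norm u by exact: ub_le_sup.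
split=> // p.
have [->|p0] := eqVneq p 0; first by rewrite u0 !normr0 mulr0.
have np : 0 < `|p| by rewrite normr_gt0.
rewrite -ler_pdivrMr //; apply: ub_le_sup => //; exists (`|p|^-1 *: p).
  by rewrite /= normrZ normfV normr_id mulVf // gt_eqF.
have -> : u (`|p|^-1 *: p) = `|p|^-1 * u p by exact: (linearZ_LR f).
by rewrite normrM normfV normr_id mulrC.
Qed.

Lemma ptws_near (phi : X -> R^o) (s : seq X) (e : R) : 0 < e ->
  nbhs (phi : {ptws X -> R^o}) [set u | forall p, p \in s -> `|u p - phi p| <= e].
Proof.
move=> e0; have FF := nbhs_filter (phi : {ptws X -> R^o}).
have /(pointwise_cvgP _ FF) cv : {ptws, nbhs (phi : {ptws X -> R^o}) --> phi} by [].
have near1 p : nbhs (phi : {ptws X -> R^o}) [set u | `|u p - phi p| <= e].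
  have /cvgrPdist_le/(_ e e0) := cv p.
  by apply: (@filterS _ _ FF) => u /=; rewrite distrC.
elim: s => [|p s IH].
  by apply: (@filterS _ _ FF setT) => //; exact: (@filterT _ _ FF).
apply: (@filterS _ _ FF _ _ _ (@filterI _ _ FF _ _ (near1 p) IH)) => u [h1 h2] q.
by rewrite inE => /orP[/eqP->//|/h2].
Qed.

Lemma efremov_of_answering : almost_disjoint F -> @answering R F -> efremov X.
Proof.
move=> adF ans C Cdual Cconv [M CM] phi phidual phicl.
have CM' u : C u -> bdd_functional `|M| u.
  move=> Cu; have [M0 ul ub] := dual_functional (Cdual _ Cu); split=> // p.
  rewrite (le_trans (ub p)) // ler_wpM2r // (le_trans (CM _ Cu)) //.
  exact: ler_norm.
have convC u v t : C u -> C v -> 0 <= t <= 1 ->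
    C (fun p => t * u p + (1 - t) * v p).
  move=> Cu Cv /andP[t0 t1].
  have := Cconv u v (Itv01 t0 t1); rewrite !inE => /(_ Cu Cv).
  by congr C.
have Ccl (s : seq X) e : 0 < e -> exists2 u, C u &
    forall p, p \in s -> `|u p - phi p| <= e.
  by move=> e0; have [u [Cu us]] := phicl _ (ptws_near phi s e0); exists u.
have phiM := dual_functional phidual.
have [v [vC ve vchi]] :=
  answering_sequence iota_lin iota_norm adF ans CM' phiM convC Ccl.
exists v; split=> //; apply/pointwise_cvgP => p.
apply/cvgrPdist_le => e e0.
have wB n : bdd_functional (`|-1| * dual_norm phi + `|M|) (fun p => -1 * phi p + v n p).
  by apply: functional_lin => //; exact: CM'.
have [k|A FA|n0 h] := to0_dense wB _ _ p e0.
- by apply: to0_le (ve k) => n; rewrite mulN1r addrC.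
- by apply: to0_le (vchi A FA) => n; rewrite mulN1r addrC.
exists n0 => // n /h; by rewrite mulN1r addrC distrC.
Qed.

End JLdense.

(** * Existence of the completion *)

Section UniformClosure.
Variables (R : realType) (J : Type) (j0 : J) (V : set (J -> R^o)).
Hypothesis V0 : V 0.
Hypothesis Vlin : forall c f g, V f -> V g -> V (c *: f + g).
Hypothesis Vbd : forall f, V f -> exists M : R, forall j, `|f j| <= M.

(** The completion is realized as the uniform closure of [V] among all functions on [J]; as uniform
    limits of bounded functions, its elements are bounded. *)
Definition uclos : {pred (J -> R^o)} :=
  fun g => `[< forall e : R, 0 < e -> exists2 f, V f & forall j, `|g j - f j| <= e >].

Lemma uclos_submod_closed : submod_closed uclos.
Proof.
split.
  apply/asboolP => e e0; exists 0 => // j.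
  by rewrite subrr normr0 ltW.
move=> c f g /asboolP fV /asboolP gV; apply/asboolP => e e0.
have c0 : 0 < `|c| + 1 by rewrite ltr_wpDl.
have e2 : 0 < e / 2 by rewrite divr_gt0.
have [f' Vf' ff'] := fV _ (divr_gt0 e2 c0).
have [g' Vg' gg'] := gV _ e2.
exists (c *: f' + g') => [|j]; first exact: Vlin.
have -> : (c *: f + g) j - (c *: f' + g') j = c * (f j - f' j) + (g j - g' j).
  by rewrite mulrBr addrACA -opprD.
rewrite (le_trans (ler_normD _ _)) // [leRHS]splitr lerD //.
rewrite normrM; have : `|c| * `|f j - f' j| <= `|c| * (e / 2 / (`|c| + 1)).
  by rewrite ler_wpM2l.
move=> /le_trans; apply; rewrite mulrA ler_pdivrMr // mulrC ler_pM2l //.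
by rewrite lerDl.
Qed.

HB.instance Definition _ :=
  GRing.isSubmodClosed.Build R (J -> R^o) uclos uclos_submod_closed.

Record uclosType := UclosType { uval :> J -> R^o ; uvalP : uval \in uclos }.

HB.instance Definition _ := [isSub for uval].
HB.instance Definition _ := [Choice of uclosType by <:].
HB.instance Definition _ := [SubChoice_isSubLmodule of uclosType by <:].

Lemma uclos_bd (g : uclosType) : exists M, forall j, `|g j| <= M.
Proof.
have /asboolP/(_ 1 ltr01)[f /Vbd[M fM] gf] := uvalP g.
exists (1 + M) => j; rewrite -(subrK (f j) (g j)) (le_trans (ler_normD _ _)) //.
by rewrite lerD.
Qed.

Definition unorm (g : uclosType) : R := sup (range (fun j => `|g j|)).

Lemma le_unorm (g : uclosType) j : `|g j| <= unorm g.
Proof.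
have [M gM] := uclos_bd g; apply: ub_le_sup; last by exists j.
by exists M => _ [i _ <-].
Qed.

Lemma unorm_le (g : uclosType) M : (forall j, `|g j| <= M) -> unorm g <= M.
Proof.
move=> gM; apply: ge_sup; first by exists `|g j0|, j0.
by move=> _ [j _ <-].
Qed.

Lemma uclosDE (f g : uclosType) j : (f + g) j = f j + g j.
Proof. by []. Qed.

Lemma unormD (f g : uclosType) : unorm (f + g) <= unorm f + unorm g.
Proof.
apply: unorm_le => j; rewrite uclosDE (le_trans (ler_normD _ _)) //.
by rewrite lerD ?le_unorm.
Qed.

Lemma unormZ (c : R) (f : uclosType) : unorm (c *: f) = `|c| * unorm f.
Proof.
have le a (g : uclosType) : unorm (a *: g) <= `|a| * unorm g.
  apply: unorm_le => j; rewrite (_ : (a *: g) j = a * g j) // normrM.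
  by rewrite ler_wpM2l ?le_unorm.
apply/eqP; rewrite eq_le le /=; have [->|c0] := eqVneq c 0.
  by rewrite normr0 mul0r (le_trans _ (le_unorm _ j0)).
rewrite -ler_pdivlMl ?normr_gt0 // -normfV.
by have := le c^-1 (c *: f); rewrite scalerA mulVf // scale1r.
Qed.

Lemma unorm0_eq0 (f : uclosType) : unorm f = 0 -> f = 0.
Proof.
move=> f0; apply/val_inj/funext => j; apply/eqP; rewrite -normr_le0 -f0.
exact: le_unorm.
Qed.

HB.instance Definition _ :=
  Lmodule_isNormed.Build R uclosType unormD unormZ unorm0_eq0.

(** The filter contains a ball of radius [e] around some [c e]. The supremum over [e] of [c e j - e]
    is within [e] of [c e j] for every [j], hence a uniform limit. *)
Lemma uclos_cauchy_cvg (G : set_system uclosType) :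
  ProperFilter G -> cauchy G -> cvg G.
Proof.
move=> FG /cauchyP Gc.
have normE (f : uclosType) : `|f| = unorm f by [].
have /choice[c cP] e : exists c : uclosType, 0 < e -> G (ball c e).
  have [e0|e0] := pselect (0 < e); last by exists 0.
  by have [c] := Gc e e0; exists c.
pose T j := [set c e j - e | e in [set e : R | 0 < e]].
have cc e e' j : 0 < e -> 0 < e' -> `|c e j - c e' j| <= e + e'.
  move=> /cP h /cP h'; have [g [h1 h2]] := filter_ex (filterI h h').
  move: h1 h2; rewrite -!ball_normE /= => /ltW h1 /ltW h2.
  have := le_trans (le_unorm (c e' - g) j) h2.
  have := le_trans (le_unorm (c e - g) j) h1.
  rewrite (_ : (c e - g) j = c e j - g j) // (_ : (c e' - g) j = c e' j - g j) //.
  move: (c e j) (c e' j) (g j) => x y z {}h1 {}h2.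
  rewrite (_ : x - y = x - z - (y - z)); last by rewrite opprB addrA subrK.
  by rewrite (le_trans (ler_normB _ _)) // lerD.
pose g (j : J) : R^o := sup (T j).
have Tub j e : 0 < e -> ubound (T j) (c e j + e).
  move=> e0 _ [e' /= e'0 <-]; have := cc e e' j e0 e'0.
  by rewrite ler_norml => /andP[? ?]; lra.
have gc e j : 0 < e -> `|g j - c e j| <= e.
  move=> e0; rewrite ler_distl; apply/andP; split.
    apply: ub_le_sup; last by exists e.
    by exists (c e j + e); exact: Tub.
  apply: ge_sup; last exact: Tub.
  by exists (c e j - e), e.
have gV : g \in uclos.
  apply/asboolP => e e0; have e2 : 0 < e / 2 by rewrite divr_gt0.
  have /asboolP/(_ _ e2)[f Vf fc] := uvalP (c (e / 2)); exists f => // j.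
  rewrite -(subrK (c (e / 2) j) (g j)) -addrA (le_trans (ler_normD _ _)) //.
  by rewrite [leRHS]splitr lerD // gc.
apply/cvg_ex; exists (UclosType gV); apply/cvgrPdist_le => e e0.
have e2 : 0 < e / 2 by rewrite divr_gt0.
have := cP _ e2; apply: filterS => h; rewrite -ball_normE /= => /ltW ch.
apply: unorm_le => j.
have := le_trans (le_unorm (c (e / 2) - h) j) ch.
rewrite (_ : (c (e / 2) - h) j = c (e / 2) j - h j) //.
rewrite (_ : (UclosType gV - h) j = g j - h j) //.
have := gc _ j e2.
rewrite !ler_norml => /andP[? ?] /andP[? ?]; apply/andP; split; lra.
Qed.

HB.instance Definition _ :=
  Uniform_isComplete.Build uclosType uclos_cauchy_cvg.

Lemma exists_uniform_completion :
  exists (X : completeNormedModType R) (io : (J -> R^o) -> X),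
  [/\ forall c f g, V f -> V g -> io (c *: f + g) = c *: io f + io g,
    forall f, V f -> `|io f| = sup (range (fun j => `|f j|)) &
    closure (io @` V) = [set: X]].
Proof.
have Vu f : V f -> f \in uclos.
  by move=> Vf; apply/asboolP => e e0; exists f => // j; rewrite subrr normr0 ltW.
pose io (f : J -> R^o) : uclosType := insubd (0 : uclosType) f.
have ioE f : V f -> uval (io f) = f.
  by move=> /Vu; exact: (insubdK (0 : uclosType)).
exists uclosType, io; split.
- move=> c f g Vf Vg; apply: (val_inj : injective uval); rewrite ioE; last exact: Vlin.
  by rewrite -[RHS]/(c *: uval (io f) + uval (io g)) !ioE.
- by move=> f Vf; rewrite -[LHS]/(unorm _) /unorm ioE.
- apply/seteqP; split=> // g _ B /nbhs_ballP[e /= e0 eB].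
  have /asboolP/(_ (e / 2))[|f Vf gf] := uvalP g; first by rewrite divr_gt0.
  exists (io f); split; first by exists f.
  apply: eB; rewrite -ball_normE /=.
  apply: (@le_lt_trans _ _ (e / 2)); last by rewrite ltr_pdivrMr // ltr_pMr // ltr1n.
  apply: unorm_le => j; rewrite -[(g - io f) j]/(g j - io f j) ioE //.
Qed.

End UniformClosure.

(** * The span as a space of bounded functions *)

Section Existence.
Variables (R : realType) (F : set (set nat)).
Hypothesis adF : almost_disjoint F.
Implicit Types (A : set nat) (f g : nat -> R^o).

Lemma jl_span_c0D f x : jl_span F f -> c0 x -> jl_span F (x + f).
Proof.
move=> [y [k [N [a [[y0 Ninj FN] ->]]]]] x0.
exists (x + y), k, N, a; split; first by split=> //; exact: c0D.
by apply/funext => n; rewrite /jl_sum addrA.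
Qed.

(** [jl_data] asks for distinct sets: if [A] already occurs its coefficient is changed, otherwise
    [A] is put in front. *)
Lemma jl_span_indD f A (c : R) : jl_span F f -> F A ->
  jl_span F (c *: (\1_A : nat -> R^o) + f).
Proof.
move=> [x [k [N [a [[x0 Ninj FN] ->]]]]] FA.
have [[r0 r0A]|nA] := pselect (exists r, N r = A).
  exists x, k, N, (fun r => a r + c * (r == r0)%:R); split=> //.
  apply/funext => n; rewrite /jl_sum.
  rewrite -[LHS]/(c * \1_A n + (x n + \sum_(r < k) a r * \1_(N r) n)).
  under [in RHS]eq_bigr do rewrite mulrDl.
  rewrite big_split /= (_ : \sum_(r < k) c * (r == r0)%:R * \1_(N r) n =
    c * \1_A n); first by ring.
  rewrite (bigD1 r0) //= big1 => [|r /negbTE ->]; last by rewrite mulr0 mul0r.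
  by rewrite eqxx mulr1 addr0 r0A.
exists x, k.+1, (fun r => if unlift ord0 r is Some r' then N r' else A),
  (fun r => if unlift ord0 r is Some r' then a r' else c); split.
  split=> // [r s|r]; last by case: unliftP.
  case: unliftP => [r' ->|->]; case: unliftP => [s' ->|->] //.
  - by move=> /Ninj ->.
  - by move=> h; case: nA; exists r'.
  - by move=> h; case: nA; exists s'.
apply/funext => n; rewrite /jl_sum big_ord_recl unlift_none.
rewrite -[LHS]/(c * \1_A n + (x n + \sum_(r < k) a r * \1_(N r) n)) addrCA.
by congr (_ + (_ + _)); apply: eq_bigr => r _; rewrite liftK.
Qed.

Lemma jl_span_lin (c : R) f g : jl_span F f -> jl_span F g ->
  jl_span F (c *: f + g).
Proof.
move=> [x [k [N [a [[x0 _ FN] ->]]]]] Fg.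
have -> : c *: jl_sum x N a + g =
    c *: x + (\sum_(r < k) (c * a r) *: (\1_(N r) : nat -> R^o) + g).
  rewrite addrA; congr (_ + _); apply/funext => n.
  rewrite -[LHS]/(c * (x n + \sum_(r < k) a r * \1_(N r) n)).
  rewrite -[RHS]/(c * x n + (\sum_(r < k) (c * a r) *: (\1_(N r) : nat -> R^o)) n).
  rewrite mulrDr fct_sumE mulr_sumr; congr (_ + _); apply: eq_bigr => r _.
  by rewrite mulrA.
apply: jl_span_c0D; last by apply/c0P/to0Z/c0P.
elim/big_rec: _ => [|r h _ IH]; first by rewrite add0r.
by rewrite -addrA; exact: jl_span_indD.
Qed.

Definition cvg_along A f (l : R) :=
  forall e, 0 < e -> exists n0, forall n, (n0 <= n)%N -> A n -> `|f n - l| <= e.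

(** On the span this recovers the coefficient of [\1_A] from [f] alone, without reference to a
    representation as a sum. *)
Definition lim_along A f : R := xget 0 [set l | cvg_along A f l].

Lemma infinite_nat_ge A m : infinite_set A -> exists2 n, (m <= n)%N & A n.
Proof.
move=> Ainf; apply: contrapT => nA; apply: Ainf.
apply: (sub_finite_set _ (finite_II m)) => n An /=; rewrite ltnNge.
by apply/negP => mn; apply: nA; exists n.
Qed.

Lemma lim_alongE A f l : infinite_set A -> cvg_along A f l -> lim_along A f = l.
Proof.
move=> Ainf fl; have fl' : cvg_along A f (lim_along A f).
  by apply: (@xgetPex _ 0 [set l | cvg_along A f l]); exists l.
apply/eqP; rewrite -subr_eq0; apply/eqP/to0_eq0 => e e0.
have e2 : 0 < e / 2 by rewrite divr_gt0.
exists 0%N => _ _; have [n1 h1] := fl _ e2; have [n2 h2] := fl' _ e2.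
have [n] := infinite_nat_ge (maxn n1 n2) Ainf.
rewrite geq_max => /andP[/h1 {}h1 /h2 {}h2] An.
rewrite -(subrK (f n) (lim_along A f)) -addrA (le_trans (ler_normD _ _)) //.
by rewrite [leRHS]splitr lerD ?h1 // distrC h2.
Qed.

Lemma cvg_along_lin A (c : R) f g l m : cvg_along A f l -> cvg_along A g m ->
  cvg_along A (c *: f + g) (c * l + m).
Proof.
move=> fl gm e e0; have e2 : 0 < e / 2 by rewrite divr_gt0.
have c0 : 0 < `|c| + 1 by rewrite ltr_wpDl.
have [n1 h1] := fl _ (divr_gt0 e2 c0); have [n2 h2] := gm _ e2.
exists (maxn n1 n2) => n; rewrite geq_max => /andP[/h1 {}h1 /h2 {}h2] An.
have -> : (c *: f + g) n - (c * l + m) = c * (f n - l) + (g n - m).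
  by rewrite mulrBr addrACA -opprD.
rewrite (le_trans (ler_normD _ _)) // [leRHS]splitr lerD ?h2 //.
rewrite normrM (@le_trans _ _ (`|c| * (e / 2 / (`|c| + 1)))) ?ler_wpM2l ?h1 //.
by rewrite mulrA ler_pdivrMr // mulrC ler_pM2l // lerDl.
Qed.

Section Sum.
Variables (x : nat -> R^o) (k : nat) (N : 'I_k -> set nat) (a : 'I_k -> R).
Hypothesis xN : jl_data F x N.

(** The [c0] part tends to 0, and each [N r] other than [A] meets [A] in a finite set. *)
Lemma cvg_along_jl_sum A : F A ->
  cvg_along A (jl_sum x N a) (\sum_(r < k) a r * (N r == A)%:R).
Proof.
case: xN => /c0P x0 Ninj FN FA e /x0[n0 h0].
have /choice[m mP] r : exists m, N r != A -> forall n, (N r `&` A) n -> (n < m)%N.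
  have [_|NA] := eqVneq (N r) A; first by exists 0%N.
  have [//|m mP] := @finite_set_nat_ub (N r `&` A).
    by apply: adF.2 => //; exact/eqP.
  by exists m.
exists (maxn n0 (\max_(r < k) m r)) => n; rewrite geq_max => /andP[/h0 xn mn] An.
rewrite /jl_sum -addrA -sumrB big1 ?addr0 // => r _.
rewrite -mulrBr indicE; have [NA|NA] := eqVneq (N r) A.
  by rewrite NA mem_set // subrr mulr0.
rewrite memNset ?subrr ?mulr0 // => Nrn.
have := mP r NA n (conj Nrn An); rewrite ltnNge (leq_trans _ mn) //.
exact: (leq_bigmax r).
Qed.

Lemma lim_along_jl_sum A : F A ->
  lim_along A (jl_sum x N a) = \sum_(r < k) a r * (N r == A)%:R.
Proof.
move=> FA; apply: lim_alongE; last exact: cvg_along_jl_sum.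
exact: adF.1.
Qed.

Lemma sqr_lim_along A : F A ->
  lim_along A (jl_sum x N a) ^+ 2 = \sum_(r < k) a r ^+ 2 * (N r == A)%:R.
Proof.
move=> FA; rewrite lim_along_jl_sum //.
have [[r0 r0A]|nA] := pselect (exists r, N r = A); last first.
  rewrite !big1 ?expr0n // => r _; case: eqP => [h|_]; rewrite ?mulr0 //;
    by case: nA; exists r.
have other r : r != r0 -> (N r == A) = false.
  move=> rr0; apply/eqP => h; move/eqP: rr0; apply; case: xN => _ + _; apply.
  by rewrite h r0A.
rewrite (bigD1 r0) //= [X in _ + X]big1 => [|r /other ->]; last by rewrite mulr0.
rewrite [RHS](bigD1 r0) //= [X in _ = _ + X]big1 => [|r /other ->]; last by rewrite mulr0.
by rewrite r0A eqxx !addr0 !mulr1.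
Qed.

Lemma jl_sum_bounded : exists B, forall n, `|jl_sum x N a n| <= B.
Proof.
case: xN => /c0P/(_ _ ltr01)[n0 h0] _ _.
exists (1 + \sum_(i < n0) `|x i| + \sum_(r < k) `|a r|) => n.
rewrite (le_trans (ler_normD _ _)) // lerD //.
  have [/h0 xn|nn0] := leqP n0 n.
    by rewrite (le_trans xn) // lerDl sumr_ge0.
  rewrite (bigD1 (Ordinal nn0)) //= addrCA lerDl addr_ge0 // sumr_ge0 //.
rewrite (le_trans (ler_norm_sum _ _ _)) // ler_sum // => r _.
rewrite normrM ler_piMr // indicE normr_nat.
by case: (_ \in _).
Qed.

End Sum.

(* The norm of JL_2 is the supremum of |f n| and of |sum_A b(A) lim_A f| over
   finitely supported b in the unit ball of l2(F), so that f is sent to a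
   bounded function on [jl_index]. *)
Definition jl_index : Type := (nat + seq (set nat) * (set nat -> R))%type.

Definition l2_unit (sb : seq (set nat) * (set nat -> R)) :=
  [/\ uniq sb.1, forall A, A \in sb.1 -> F A & \sum_(A <- sb.1) sb.2 A ^+ 2 <= 1].

Definition embed f (j : jl_index) : R^o :=
  match j with
  | inl n => f n
  | inr sb => if pselect (l2_unit sb) then \sum_(A <- sb.1) sb.2 A * lim_along A f
              else 0
  end.

Lemma embed_lin (c : R) f g : jl_span F f -> jl_span F g ->
  embed (c *: f + g) = c *: embed f + embed g.
Proof.
move=> Ff Fg; apply/funext => -[n //|sb].
rewrite -[RHS]/(c * embed f (inr sb) + embed g (inr sb)) /embed.
case: pselect => [vsb|_] /=; last by rewrite mulr0 addr0.
have [_ sF _] := vsb.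
rewrite mulr_sumr -big_split /= !big_seq; apply: eq_bigr => A As.
have ex h : jl_span F h -> cvg_along A h (lim_along A h).
  move=> [x [k [N [a [d ->]]]]]; rewrite lim_along_jl_sum //; last exact: sF.
  by apply: cvg_along_jl_sum => //; exact: sF.
rewrite (@lim_alongE _ _ (c * lim_along A f + lim_along A g)).
- by ring.
- by apply: adF.1; exact: sF.
- by apply: cvg_along_lin; exact: ex.
Qed.

(** The indices [inl n] give the sup norm. For the others, the upper bound is the Cauchy-Schwarz
    inequality and the lower bound its case of equality. *)
Lemma embed_norm (x : nat -> R^o) k (N : 'I_k -> set nat) (a : 'I_k -> R) :
  jl_data F x N ->
  has_ubound (range (fun j => `|embed (jl_sum x N a) j|)) /\
  sup (range (fun j => `|embed (jl_sum x N a) j|)) =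
    Num.max (sup_norm (jl_sum x N a)) (Num.sqrt (\sum_(r < k) a r ^+ 2)).
Proof.
move=> d; set f := jl_sum x N a; set S := \sum_(r < k) _; set q := Num.sqrt S.
have [B fB] := jl_sum_bounded a d.
have fub : has_ubound (range (fun n => `|f n|)) by exists B => _ [n _ <-].
have S0 : 0 <= S by apply: sumr_ge0 => r _; exact: sqr_ge0.
have q0 : 0 <= q by exact: sqrtr_ge0.
have qS : q ^+ 2 = S by exact: sqr_sqrtr.
have sumS s : uniq s -> (forall A, A \in s -> F A) ->
    \sum_(A <- s) lim_along A f ^+ 2 = \sum_(r < k) a r ^+ 2 * (N r \in s)%:R.
  move=> su sF; rewrite big_seq; under eq_bigr => A As do
    rewrite (sqr_lim_along _ d (sF _ As)).
  rewrite -big_seq exchange_big /=; apply: eq_bigr => r _.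
  rewrite -mulr_sumr -(count_uniq_mem _ su) -sum1_count natr_sum big_mkcond /=.
  congr (_ * _); rewrite big_mkcond [RHS]big_mkcond /=.
  by apply: eq_bigr => A _; rewrite eq_sym; case: eqP.
have emb_le j : `|embed f j| <= Num.max (sup_norm f) q.
  rewrite le_max; case: j => [n|[s b]] /=.
    by rewrite (ub_le_sup fub) //; exists n.
  apply/orP; right; case: pselect => [vsb|_] /=; last by rewrite normr0.
  have [/= su sF sb] := vsb.
  have Ss : \sum_(A <- s) lim_along A f ^+ 2 <= S.
    rewrite sumS //; apply: ler_sum => r _; rewrite ler_piMr ?sqr_ge0 //.
    by case: (_ \in _).
  have [Sz|q0'] := eqVneq q 0.
    have z A : A \in s -> lim_along A f = 0.
      move=> As; apply/eqP; rewrite -sqrf_eq0 eq_le sqr_ge0 andbT.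
      apply: (@le_trans _ _ S); last by rewrite -qS Sz expr0n.
      apply: le_trans Ss; rewrite (big_rem A) //= lerDl sumr_ge0 // => B' _.
      exact: sqr_ge0.
    rewrite big_seq big1 ?normr0 // => A /z ->; exact: mulr0.
  have {}q0 : 0 < q by rewrite lt_neqAle eq_sym q0'.
  (* Cauchy-Schwarz by summing [2 q |b l| <= q^2 b^2 + l^2]; dividing by [q] is why [q = 0] was
     treated apart. *)
  have : 2 * q * `|\sum_(A <- s) b A * lim_along A f| <= q ^+ 2 + S.
    apply: (@le_trans _ _ (\sum_(A <- s) (q ^+ 2 * b A ^+ 2 + lim_along A f ^+ 2))).
      rewrite -[X in X * _ <= _]ger0_norm ?mulr_ge0 ?(ltW q0) // -normrM mulr_sumr.
      rewrite (le_trans (ler_norm_sum _ _ _)) //; apply: ler_sum => A _.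
      rewrite ler_norml; apply/andP; split; rewrite -subr_ge0.
        by rewrite (_ : _ - _ = (q * b A + lim_along A f) ^+ 2) ?sqr_ge0 //; ring.
      by rewrite (_ : _ - _ = (q * b A - lim_along A f) ^+ 2) ?sqr_ge0 //; ring.
    by rewrite big_split /= -mulr_sumr lerD // ler_piMr ?sqr_ge0.
  rewrite -qS (_ : q ^+ 2 + q ^+ 2 = 2 * q * q); last by ring.
  by rewrite ler_pM2l // mulr_gt0.
have eub : has_ubound (range (fun j => `|embed f j|)).
  by exists (Num.max (sup_norm f) q) => _ [j _ <-].
split=> //; apply/eqP; rewrite eq_le; apply/andP; split.
  apply: ge_sup; first by exists `|embed f (inl 0%N)|, (inl 0%N).
  by move=> _ [j _ <-].
rewrite ge_max; apply/andP; split.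
  by apply: sup_norm_le => n; apply: (ub_le_sup eub); exists (inl n).
have [->|q0'] := eqVneq q 0.
  apply: (@le_trans _ _ `|embed f (inl 0%N)|) => //.
  by apply: (ub_le_sup eub); exists (inl 0%N).
have {}q0 : 0 < q by rewrite lt_neqAle eq_sym q0'.
(* The normalized coefficients: a unit vector of l2(F) at which [q] is attained. *)
pose s := map N (enum 'I_k); pose b A := lim_along A f / q.
have Ninj : injective N by case: d.
have su : uniq s by rewrite map_inj_uniq // enum_uniq.
have sF A : A \in s -> F A by move=> /mapP[r _ ->]; case: d.
have sS : \sum_(A <- s) lim_along A f ^+ 2 = S.
  rewrite sumS //; apply: eq_bigr => r _.
  by rewrite map_f ?mulr1 // mem_enum.
have vs : l2_unit (s, b).
  split=> //=; rewrite /b; under eq_bigr do rewrite exprMn.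
  by rewrite -mulr_suml sS -qS exprVn divff // expf_neq0 // gt_eqF.
apply: ub_le_sup => //; exists (inr (s, b)) => //=.
case: pselect => [_|nv] /=; last by case: nv.
rewrite /b.
rewrite (_ : \sum_(A <- s) _ = q) ?ger0_norm ?(ltW q0) //.
transitivity ((\sum_(A <- s) lim_along A f ^+ 2) / q).
  by rewrite mulr_suml; apply: eq_bigr => A _; rewrite expr2; ring.
by rewrite sS -qS expr2 mulfK // gt_eqF.
Qed.

Lemma exists_JL2 : exists X : completeNormedModType R, is_JL2 F X.
Proof.
have [|||X [io [iolin ionorm iodense]]] :=
  @exists_uniform_completion R jl_index (inl 0%N) (embed @` jl_span F).
- exists 0; first by apply: span_c0; apply: (@c0_finsupp _ _ 0).
  apply/funext => -[//|sb]; rewrite /embed; case: pselect => // vsb.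
  have [_ sF _] := vsb.
  rewrite big_seq big1 // => A As; rewrite (@lim_alongE _ _ 0) ?mulr0 //.
    by apply: adF.1; exact: sF.
  by move=> e e0; exists 0%N => n _ _; rewrite subrr normr0 ltW.
- move=> c _ _ [f Ff <-] [g Fg <-]; exists (c *: f + g).
    exact: jl_span_lin.
  exact: embed_lin.
- move=> _ [_ [x [k [N [a [d ->]]]]] <-]; have [[M hM] _] := embed_norm a d.
  by exists M => j; apply: hM; exists j.
- exists X, (io \o embed); split.
  + move=> c f g Ff Fg /=; rewrite embed_lin // iolin //; by [exists f|exists g].
  + move=> x k N a d /=; rewrite ionorm; first exact: (embed_norm a d).2.
    by exists (jl_sum x N a) => //; exists x, k, N, a.
  + by rewrite -iodense image_comp.
Qed.

End Existence.

(** Infinitude excludes the trivial finite MAD families. Property (E) is shown for every completion,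
    and the existence of one keeps that clause from being vacuous. *)
Theorem corollary3p5 (R : realType) (CH : continuum_hypothesis) :
  exists F : set (set nat),
    [/\ mad_family F,
        infinite_set F,
        (exists X : completeNormedModType R, is_JL2 F X)
      & forall X : completeNormedModType R, is_JL2 F X -> efremov X].
Proof.
have [F [madF infF ansF]] := ch_answering_mad R CH; have [adF _] := madF.
exists F; split=> //; first exact: exists_JL2.
move=> X [io [iolin ionorm iodense]].
exact: (efremov_of_answering iolin ionorm iodense adF ansF).
Qed.
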